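(* Let $q\in\mathbb{N}$ be a positive integer, let $\delta,b,c>0$ be real, let $p$ be real with $p+1>0$, and let $\alpha\in[0,1)$. Write $W={}_{q}W_{p,b,c,\delta}$ for the generalized Struve function and $f={}_{q}f_{p,b,c,\delta}$, $g={}_{q}g_{p,b,c,\delta}$, $h={}_{q}h_{p,b,c,\delta}$ for its three normalizations. Then: (a) The radius of convexity of order $\alpha$ of $f$ is the smallest positive root of the equation $$1+\left(\frac{1}{p+1}-1\right)\frac{rW'(r)}{W(r)}+\frac{rW''(r)}{W'(r)}=\alpha.$$ (b) The radius of convexity of order $\alpha$ of $g$ is the smallest positive root of the equation $$1+\frac{r\,g''(r)}{g'(r)}=\alpha.$$ (c) The radius of convexity of order $\alpha$ of $h$ is the smallest positive root of the equation $$1+\frac{r\,h''(r)}{h'(r)}=\alpha.$$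
   Context: The generalized Struve function is $${}_{q}W_{p,b,c,\delta}(z)=\sum_{n\geq 0}\frac{(-1)^{n}c^n}{n!\,\Gamma\left(qn+\frac{p}{\delta}+\frac{b+2}{2}\right)}\left(\frac{z}{2}\right)^{2n+p+1},\qquad q\in\mathbb{N},\ \delta>0.$$ Its three normalizations, each analytic near $0$ with value $0$ and derivative $1$ at $0$, are $${}_{q}f_{p,b,c,\delta}(z)=\left(2^{p+1}\Gamma\left(\tfrac{p}{\delta}+\tfrac{b+2}{2}\right){}_{q}W_{p,b,c,\delta}(z)\right)^{\frac{1}{p+1}},$$ $${}_{q}g_{p,b,c,\delta}(z)=2^{p+1}\Gamma\left(\tfrac{p}{\delta}+\tfrac{b+2}{2}\right)z^{-p}\,{}_{q}W_{p,b,c,\delta}(z),$$ $${}_{q}h_{p,b,c,\delta}(z)=2^{p+1}\Gamma\left(\tfrac{p}{\delta}+\tfrac{b+2}{2}\right)z^{1-\frac{p+1}{2}}\,{}_{q}W_{p,b,c,\delta}(\sqrt{z}).$$ Here $g$ and $h$ are the entire functions obtained by cancelling the powers of $z$ in the series, and $f(z)=z\,(\cdots)^{1/(p+1)}$ with the branch equal to $1$ at $z=0$. With $\mathbb{D}_r=\{z\in\mathbb{C}:|z|<r\}$, the radius of convexity of order $\alpha$ of $F$ is $$r^{c}_{\alpha}(F)=\sup\left\{r>0:\ \operatorname{Re}\left(1+\frac{zF''(z)}{F'(z)}\right)>\alpha\ \text{for all } z\in\mathbb{D}_r\right\}.$$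
   Formalization: The formal theorem additionally assumes p/δ + (b+2)/2 > 0; without it the Gamma factor may be undefined and (b) can fail, e.g. q = b = c = 1, p = −1/2, δ = 1/4, where g' has a zero on the imaginary axis below 0.75. *)

(* Defs.v *)
From Stdlib Require Import Reals Factorial.
From Coquelicot Require Import Coquelicot.

Local Open Scope R_scope.

(* Euler's integral; it converges, and is the Gamma function, only for
   0 < x. *)
Definition Gamma (x : R) : R :=
  RInt_gen (fun t => Rpower t (x - 1) * exp (- t))
    (at_right 0) (Rbar_locally p_infty).

(* Coquelicot's [Series] is real-valued. *)
Definition CSeries (a : nat -> C) : C :=
  (Series (fun n => Re (a n)), Series (fun n => Im (a n))).

Definition Cexp (z : C) : C := (exp (Re z) * cos (Im z), exp (Re z) * sin (Im z)).

Definition struve_kappa (p b delta : R) : R := p / delta + (b + 2) / 2.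

Definition struve_coeff (q : nat) (p b c delta : R) (n : nat) : R :=
  (- 1) ^ n * c ^ n
  / (INR (fact n) * Gamma (INR q * INR n + struve_kappa p b delta)).

(* The generalized Struve function on the half-line 0 < x, where the power
   (x / 2) ^ (2 n + p + 1) is unambiguous. *)
Definition struve_W (q : nat) (p b c delta x : R) : R :=
  Series (fun n => struve_coeff q p b c delta n
                   * Rpower (x / 2) (2 * INR n + p + 1)).

(* 2 ^ (p + 1) Gamma(kappa) z ^ (- (p + 1)) W(z), using
   2 ^ (p + 1) z ^ (- (p + 1)) (z / 2) ^ (2 n + p + 1) = (z / 2) ^ (2 n);
   an even entire function with value 1 at 0. *)
Definition struve_phi (q : nat) (p b c delta : R) (z : C) : C :=
  (Gamma (struve_kappa p b delta)
   * CSeries (fun n => struve_coeff q p b c delta n * (z / 2) ^ (2 * n)%nat))%C.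

(* The continuous logarithm of u along the segment [0, z], for u with u 0 = 1
   and without zeros on that segment (a meaningless value otherwise).  On a
   disk around 0 where u is holomorphic without zeros this is the holomorphic
   logarithm of u vanishing at 0; the principal logarithm of u need not be
   continuous on such a disk. *)
Definition Clog_branch (u : C -> C) (z : C) : C :=
  RInt (V := C_R_CompleteNormedModule)
    (fun t : R => (z * C_derive u (t * z) / u (t * z))%C) 0 1.

Definition struve_f (q : nat) (p b c delta : R) (z : C) : C :=
  (z * Cexp (Clog_branch (struve_phi q p b c delta) z * (/ (p + 1))%R))%C.

(* 2 ^ (p + 1) z ^ (- p) (z / 2) ^ (2 n + p + 1) = z (z / 2) ^ (2 n). *)
Definition struve_g (q : nat) (p b c delta : R) (z : C) : C :=
  (z * struve_phi q p b c delta z)%C.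

(* 2 ^ (p + 1) z ^ (1 - (p + 1) / 2) (sqrt z / 2) ^ (2 n + p + 1)
   = z (z / 4) ^ n. *)
Definition struve_h (q : nat) (p b c delta : R) (z : C) : C :=
  (z * (Gamma (struve_kappa p b delta)
        * CSeries (fun n => struve_coeff q p b c delta n * (z / 4) ^ n)))%C.

(* Differentiability and F' z <> 0 are explicit because [C_derive] and
   division are total. *)
Definition convex_of_order_on_disk (alpha : R) (F : C -> C) (r : R) : Prop :=
  forall z : C, Cmod z < r ->
    ex_derive (K := C_AbsRing) (V := C_NormedModule) F z /\
    ex_derive (K := C_AbsRing) (V := C_NormedModule) (C_derive F) z /\
    C_derive F z <> 0%C /\
    alpha < Re (1 + z * C_derive (C_derive F) z / C_derive F z)%C.

Definition convexity_radius (alpha : R) (F : C -> C) : Rbar :=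
  Lub_Rbar (fun r => 0 < r /\ convex_of_order_on_disk alpha F r).

Definition is_smallest_positive_root (E : R -> Prop) (r : R) : Prop :=
  0 < r /\ E r /\ forall s : R, 0 < s -> E s -> r <= s.

(* In both equations a root must make the denominators nonzero, since x / 0 is
   a junk value. *)
Definition struve_f_equation (q : nat) (p b c delta alpha : R) (r : R) : Prop :=
  let W := struve_W q p b c delta in
  W r <> 0 /\ Derive W r <> 0 /\
  1 + (1 / (p + 1) - 1) * (r * Derive W r / W r)
    + r * Derive_n W 2 r / Derive W r = alpha.

Definition convexity_equation (alpha : R) (F : C -> C) (r : R) : Prop :=
  C_derive F r <> 0%C /\
  (1 + r * C_derive (C_derive F) r / C_derive F r)%C = RtoC alpha.

(* Main.v *)
(** The zeros of the functions involved are never located.  Call a power series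
    [phi] with [phi(0) = 1] good if [u = - x phi' / phi] has nonnegative
    coefficients.  If [phi] is good and [s > 0] then so is
    [phi + x phi' / s = phi (1 - u / s)], because
    [1 / (1 - u / s)] is the geometric series in [u / s].  These operators multiply the
    [n]-th coefficient by [(n + s) / s]; since [1 / (a)_n] is a limit of products of such
    factors and of powers [t ^ n], goodness passes from [exp (- c x)] to
    [sum (- c) ^ n x ^ n / (n! (kappa)_{q n})], the normalized Struve series.

    For [F = z phi ^ (1 / s)] (with [s = 1] for g and h, [s = p + 1] for f) one finds
    [1 + z F'' / F' = 1 - k(z)], [k = u / s + x (u / s)' / (1 - u / s)], again with
    nonnegative coefficients, so [Re k(z) <= k(|z|)] and the radius of convexity is
    the point where [k(r) = 1 - alpha].  That [k] reaches this value inside its disk of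
    convergence is a Pringsheim-type statement: where [k] converges so does
    [A = 1 / (phi (1 - u / s))], and the set of convergence points of [A] is open by the
    Neumann series in the l1 algebra. *)
Require Import Defs.
From Stdlib Require Import Reals Lra Lia Arith FunctionalExtensionality Classical.
From Coquelicot Require Import Coquelicot.
Local Open Scope R_scope.

(** * Formal power series *)

(** The guiding example is $\phi=\prod_j(1-x/a_j)$ with all $a_j>0$, where
    $u=\sum_j\sum_{n\ge1}(x/a_j)^n$: nonnegative coefficients of $u$ are the trace that positive
    zeros leave on Taylor coefficients, and this trace can be followed formally. Dividing by a
    series with constant term 1 needs no convergence and makes each coefficient of $u$ a polynomial
    in finitely many coefficients of $\phi$. Hence the condition is closed under coefficientwise
    limits, without control of convergence on disks. Analysis is postponed: identities are proved as
    ring identities between coefficient sequences and then evaluated at complex or real points,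
    where only absolute convergence has to be checked. The delicate point there is that $k$ is a
    quotient whose disk of convergence is unknown: positive coefficients alone would allow $k$ to
    stay bounded up to the boundary of that disk, below the required value. The formal inverse $A$
    serves twice: it rules this out, and its convergence shows that the denominators have no zeros
    on the disk. *)

Notation ps := (nat -> R).
Definition ps0 : ps := fun _ => 0.
Definition psC (t : R) : ps := fun n => match n with O => t | S _ => 0 end.
Definition ps1 : ps := psC 1.
Definition psD (a b : ps) : ps := fun n => a n + b n.
Definition psN (a : ps) : ps := fun n => - a n.
Definition psB (a b : ps) : ps := fun n => a n - b n.
Definition psZ (t : R) (a : ps) : ps := fun n => t * a n.
Definition shift (a : ps) : ps := fun n => a (S n).

(** The Cauchy product with the head of the first factor peeled off, $(a_0+xa')b=a_0b+x(a'b)$, so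
    that the ring laws follow by induction on the index with the first factor general. *)
Fixpoint psM (a b : ps) (n : nat) : R :=
  match n with
  | O => a O * b O
  | S k => a O * b (S k) + psM (shift a) b k
  end.

Declare Scope ps_scope.
Delimit Scope ps_scope with ps.
Infix "+" := psD : ps_scope.
Infix "-" := psB : ps_scope.
Infix "*" := psM : ps_scope.
Notation "- a" := (psN a) : ps_scope.

Lemma psM_Dl a b c n : psM (a + b)%ps c n = psM a c n + psM b c n.
Proof.
  revert a b; induction n as [|n IH]; intros a b; simpl.
  - unfold psD; ring.
  - change (shift (a + b)%ps) with (shift a + shift b)%ps.
    rewrite IH; unfold psD; ring.
Qed.

Lemma psM_Zl t a c n : psM (psZ t a) c n = t * psM a c n.
Proof.
  revert a; induction n as [|n IH]; intros a; simpl.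
  - unfold psZ; ring.
  - change (shift (psZ t a)) with (psZ t (shift a)).
    rewrite IH; unfold psZ; ring.
Qed.

Lemma psM_Sr a b n : psM a b (S n) = a (S n) * b O + psM a (shift b) n.
Proof.
  revert a; induction n as [|n IH]; intros a.
  - simpl; unfold shift; ring.
  - change (a O * b (S (S n)) + psM (shift a) b (S n)
            = a (S (S n)) * b O + (a O * shift b (S n) + psM (shift a) (shift b) n)).
    rewrite IH; unfold shift; ring.
Qed.

Lemma psM_comm a b : (a * b)%ps = (b * a)%ps.
Proof.
  apply functional_extensionality; intro n.
  revert a b; induction n as [|n IH]; intros a b.
  - simpl; ring.
  - rewrite psM_Sr; simpl; rewrite (IH a); ring.
Qed.

Lemma psM_assoc a b c : (a * (b * c))%ps = ((a * b) * c)%ps.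
Proof.
  apply functional_extensionality; intro n.
  revert a; induction n as [|n IH]; intros a.
  - simpl; ring.
  - change (psM a (b * c)%ps (S n))
      with (a O * (b * c)%ps (S n) + psM (shift a) (b * c)%ps n).
    change (psM (a * b)%ps c (S n))
      with ((a * b)%ps O * c (S n) + psM (psD (psZ (a O) (shift b)) (shift a * b)%ps) c n).
    rewrite IH, psM_Dl, psM_Zl; simpl; ring.
Qed.

Lemma psM_0l a n : psM ps0 a n = 0.
Proof.
  induction n as [|n IH]; simpl.
  - unfold ps0; ring.
  - change (shift ps0) with ps0; rewrite IH; unfold ps0; ring.
Qed.

Lemma psM_Cl t a n : psM (psC t) a n = t * a n.
Proof.
  destruct n as [|n]; simpl; [reflexivity|].
  change (shift (psC t)) with ps0; rewrite psM_0l; ring.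
Qed.

Lemma ps_ring_theory : ring_theory ps0 ps1 psD psM psB psN eq.
Proof.
  constructor; intros; try (apply functional_extensionality; intro n);
    try (unfold psD, psB, psN, ps0; ring).
  - unfold ps1; rewrite psM_Cl; ring.
  - now rewrite psM_comm.
  - now rewrite psM_assoc.
  - now rewrite psM_Dl.
Qed.
Add Ring ps_ring : ps_ring_theory.

Lemma psM_C t a : (psC t * a)%ps = psZ t a.
Proof. apply functional_extensionality; intro n; apply psM_Cl. Qed.

(** * The derivation x d/dx and series with nonnegative coefficients *)

Definition theta (a : ps) : ps := fun n => INR n * a n.

Lemma theta_B a b : theta (a - b)%ps = (theta a - theta b)%ps.
Proof. apply functional_extensionality; intro n; unfold theta, psB; ring. Qed.

Lemma theta_C t : theta (psC t) = ps0.
Proof.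
  apply functional_extensionality; intros [|n]; unfold theta, ps0; simpl; ring.
Qed.

Lemma theta_1 : theta ps1 = ps0.
Proof. apply theta_C. Qed.

Lemma shift_theta a : shift (theta a) = (theta (shift a) + shift a)%ps.
Proof.
  apply functional_extensionality; intro n; unfold shift, theta, psD.
  rewrite S_INR; ring.
Qed.

Lemma theta_M a b : theta (a * b)%ps = (theta a * b + a * theta b)%ps.
Proof.
  apply functional_extensionality; intro n.
  revert a; induction n as [|n IH]; intro a.
  - unfold theta, psD; simpl; ring.
  - unfold psD.
    change (psM (theta a) b (S n)) with (theta a O * b (S n) + psM (shift (theta a)) b n).
    change (psM a (theta b) (S n)) with (a O * theta b (S n) + psM (shift a) (theta b) n).
    rewrite shift_theta, psM_Dl.
    specialize (IH (shift a)); unfold psD in IH.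
    replace (psM (theta (shift a)) b n + psM (shift a) b n)
      with (theta (shift a * b)%ps n - psM (shift a) (theta b) n + psM (shift a) b n)
      by (rewrite IH; ring).
    unfold theta; rewrite S_INR; simpl psM; simpl (INR 0); ring.
Qed.

Lemma theta_Z t a : theta (psZ t a) = psZ t (theta a).
Proof. apply functional_extensionality; intro n; unfold theta, psZ; ring. Qed.

Definition nonneg (a : ps) : Prop := forall n, 0 <= a n.

Lemma nonneg_D a b : nonneg a -> nonneg b -> nonneg (a + b)%ps.
Proof. intros Ha Hb n; unfold psD; specialize (Ha n); specialize (Hb n); lra. Qed.

Lemma nonneg_Z t a : 0 <= t -> nonneg a -> nonneg (psZ t a).
Proof. intros Ht Ha n; now apply Rmult_le_pos. Qed.

Lemma nonneg_M a b : nonneg a -> nonneg b -> nonneg (a * b)%ps.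
Proof.
  intros Ha Hb n; revert a Ha; induction n as [|n IH]; intros a Ha; simpl.
  - now apply Rmult_le_pos.
  - apply Rplus_le_le_0_compat; [now apply Rmult_le_pos|].
    apply IH; intro k; apply Ha.
Qed.

Lemma nonneg_theta a : nonneg a -> nonneg (theta a).
Proof. intros Ha n; apply Rmult_le_pos; [apply pos_INR|apply Ha]. Qed.

Lemma psM_ext a a' b b' n :
  (forall k, (k <= n)%nat -> a k = a' k) -> (forall k, (k <= n)%nat -> b k = b' k) ->
  psM a b n = psM a' b' n.
Proof.
  revert a a'; induction n as [|n IH]; intros a a' Ha Hb; simpl.
  - now rewrite Ha, Hb by lia.
  - rewrite (Ha O), (Hb (S n)) by lia; f_equal.
    apply IH; intros k Hk; [apply Ha|apply Hb]; lia.
Qed.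

Fixpoint psX (a : ps) (k : nat) : ps :=
  match k with O => ps1 | S j => (a * psX a j)%ps end.

Fixpoint psX_sum (a : ps) (k : nat) : ps :=
  match k with O => ps1 | S j => (psX_sum a j + psX a (S j))%ps end.

(* The inverse of [1 - w] when [w 0 = 0]. *)
Definition geom (w : ps) : ps := fun n => psX_sum w n n.

(** Since [w] starts in degree 1, $w^k$ starts in degree at least $k$: coefficient $n$ of the
    geometric series is settled after $n$ powers, whatever [w] does analytically. *)
Lemma psX_small w k n : w O = 0 -> (n < k)%nat -> psX w k n = 0.
Proof.
  intro H0; revert n; induction k as [|k IH]; intros n Hn; [lia|].
  change (psX w (S k)) with (w * psX w k)%ps.
  destruct n as [|n].
  - simpl; rewrite H0; ring.
  - simpl; rewrite H0.
    rewrite (psM_ext _ (shift w) _ ps0); auto.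
    + rewrite psM_comm, psM_0l; ring.
    + intros j Hj; apply IH; lia.
Qed.

Lemma geom_sum w n N : w O = 0 -> (n <= N)%nat -> geom w n = psX_sum w N n.
Proof.
  intros H0 HN; unfold geom; induction HN as [|N HN IH]; [reflexivity|].
  change (psX_sum w (S N)) with (psX_sum w N + psX w (S N))%ps.
  unfold psD; rewrite (psX_small w (S N)) by (auto; lia); rewrite <- IH; ring.
Qed.

Lemma psX_sum_telescope w N : ((ps1 - w) * psX_sum w N)%ps = (ps1 - psX w (S N))%ps.
Proof.
  induction N as [|N IH].
  - simpl; ring.
  - change (psX_sum w (S N)) with (psX_sum w N + psX w (S N))%ps.
    change (psX w (S (S N))) with (w * psX w (S N))%ps.
    replace ((ps1 - w) * (psX_sum w N + psX w (S N)))%ps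
      with ((ps1 - w) * psX_sum w N + (ps1 - w) * psX w (S N))%ps by ring.
    rewrite IH; ring.
Qed.

Lemma geom_inv w : w O = 0 -> ((ps1 - w) * geom w)%ps = ps1.
Proof.
  intro H0; apply functional_extensionality; intro n.
  rewrite (psM_ext _ (ps1 - w)%ps _ (psX_sum w n)); auto.
  - rewrite psX_sum_telescope; unfold psB; rewrite psX_small by (auto; lia); ring.
  - intros k Hk; now apply geom_sum.
Qed.

Lemma nonneg_1 : nonneg ps1.
Proof. intros [|n]; unfold ps1, psC; lra. Qed.

Lemma nonneg_X w k : nonneg w -> nonneg (psX w k).
Proof. intro H; induction k; [apply nonneg_1|now apply nonneg_M]. Qed.

Lemma nonneg_geom w : nonneg w -> nonneg (geom w).
Proof.
  intros H n; unfold geom.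
  enough (E : forall k, nonneg (psX_sum w k)) by apply E.
  induction k; [apply nonneg_1|].
  apply nonneg_D; [assumption|now apply (nonneg_X w (S k))].
Qed.

(* [theta] is [x d/dx], so the last clause reads [phi' / phi = - u / x]. *)
Definition neg_logder (phi u : ps) : Prop :=
  phi O = 1 /\ nonneg u /\ theta phi = (- (u * phi))%ps.

Lemma neg_logder_u0 phi u : neg_logder phi u -> u O = 0.
Proof.
  intros (H1 & _ & H3); apply (f_equal (fun a => a O)) in H3.
  unfold theta, psN in H3; simpl in H3; rewrite H1 in H3; lra.
Qed.

(** Origin: for $F=z\phi^{1/s}$, the derivative $F'$ is $\phi^{1/s-1}$ times this series; for $s=1$
    it is $F'$ itself. *)
Definition Top (s : R) (phi : ps) : ps := (phi + psZ (/ s) (theta phi))%ps.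
(** This is $-x\frac{d}{dx}\log(1-u/s)$; the quotient is formal, [u] having no constant term in all
    uses. *)
Definition Mser (s : R) (u : ps) : ps :=
  (geom (psZ (/ s) u) * psZ (/ s) (theta u))%ps.

Lemma Top_fact s phi u : neg_logder phi u ->
  Top s phi = (phi * (ps1 - psZ (/ s) u))%ps.
Proof.
  intros (_ & _ & H); unfold Top; rewrite H, <- !psM_C; ring.
Qed.

Lemma Mser_eq s u : u O = 0 ->
  (Mser s u * (ps1 - psZ (/ s) u))%ps = psZ (/ s) (theta u).
Proof.
  intro H; unfold Mser.
  assert (E : ((ps1 - psZ (/ s) u) * geom (psZ (/ s) u))%ps = ps1).
  { apply geom_inv; unfold psZ; rewrite H; ring. }
  transitivity ((ps1 - psZ (/ s) u) * geom (psZ (/ s) u) * psZ (/ s) (theta u))%ps; [ring|].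
  rewrite E; ring.
Qed.

Lemma nonneg_Mser s u : 0 < s -> nonneg u -> nonneg (Mser s u).
Proof.
  intros Hs Hu; assert (0 <= / s) by (left; now apply Rinv_0_lt_compat).
  apply nonneg_M; [apply nonneg_geom|]; apply nonneg_Z; auto using nonneg_theta.
Qed.

(** Logarithmic derivatives add over the factorization in [Top_fact]: [phi] contributes [u], and
    $1-u/s$ contributes [Mser s u]. *)
Lemma neg_logder_Top s phi u : 0 < s -> neg_logder phi u ->
  neg_logder (Top s phi) (u + Mser s u)%ps.
Proof.
  intros Hs H; pose proof (neg_logder_u0 _ _ H) as H0.
  pose proof (Top_fact s _ _ H) as HT.
  pose proof H as (H1 & H2 & H3); repeat split.
  - unfold Top, psD, psZ, theta; simpl; rewrite H1; ring.
  - apply nonneg_D; auto using nonneg_Mser.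
  - rewrite HT, theta_M, theta_B, theta_1, theta_Z, H3, <- (Mser_eq s u H0); ring.
Qed.

(** Substitution of $tx$ for $x$; later it also carries the l1 norm at radius $t$ to the one at
    radius 1. *)
Definition sc (t : R) (a : ps) : ps := fun n => a n * t ^ n.

Lemma sc_M t a b : sc t (a * b)%ps = (sc t a * sc t b)%ps.
Proof.
  apply functional_extensionality; intro n; unfold sc at 1.
  revert a; induction n as [|n IH]; intro a.
  - unfold sc; simpl; ring.
  - simpl psM; replace (shift (sc t a)) with (psZ t (sc t (shift a))).
    + rewrite psM_Zl, <- IH; unfold sc; simpl; ring.
    + apply functional_extensionality; intro k; unfold psZ, sc, shift; simpl; ring.
Qed.

Lemma sc_theta t a : theta (sc t a) = sc t (theta a).
Proof. apply functional_extensionality; intro n; unfold theta, sc; ring. Qed.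

Lemma sc_N t a : sc t (- a)%ps = (- sc t a)%ps.
Proof. apply functional_extensionality; intro n; unfold psN, sc; ring. Qed.

Lemma neg_logder_sc t phi u : 0 <= t -> neg_logder phi u ->
  neg_logder (sc t phi) (sc t u).
Proof.
  intros Ht (H1 & H2 & H3); repeat split.
  - unfold sc; rewrite H1; simpl; ring.
  - intro n; apply Rmult_le_pos; [apply H2|now apply pow_le].
  - now rewrite sc_theta, H3, sc_N, sc_M.
Qed.

(* Substitution of [x ^ 2] for [x]. *)
Fixpoint sq_subst (a : ps) (n : nat) : R :=
  match n with
  | O => a O
  | S O => 0
  | S (S k) => sq_subst (shift a) k
  end.

Lemma nat_ind2 (P : nat -> Prop) :
  P O -> P 1%nat -> (forall n, P n -> P (S (S n))) -> forall n, P n.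
Proof.
  intros H0 H1 HS n; enough (P n /\ P (S n)) by tauto.
  induction n; [auto|]; split; [tauto|]; apply HS; tauto.
Qed.

Lemma sq_subst_M a b : sq_subst (a * b)%ps = (sq_subst a * sq_subst b)%ps.
Proof.
  apply functional_extensionality; intro n; revert a.
  induction n as [| |n IH] using nat_ind2; intro a.
  - reflexivity.
  - simpl; unfold shift; simpl; ring.
  - change (sq_subst (shift (a * b)%ps) n
      = a O * sq_subst (shift b) n + (0 * sq_subst b (S n) + psM (sq_subst (shift a)) (sq_subst b) n)).
    rewrite <- IH.
    change (shift (a * b)%ps) with (psZ (a O) (shift b) + shift a * b)%ps.
    enough (E : forall c d k, sq_subst (psZ (a O) c + d)%ps k = a O * sq_subst c k + sq_subst d k).
    { rewrite E; ring. }
    intros c d k; revert c d; induction k as [| |k IHk] using nat_ind2; intros c d; simpl.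
    + reflexivity.
    + ring.
    + apply (IHk (shift c) (shift d)).
Qed.

Lemma sq_subst_even a n : sq_subst a (2 * n) = a n.
Proof.
  revert a; induction n as [|n IH]; intro a; [reflexivity|].
  replace (2 * S n)%nat with (S (S (2 * n))) by lia; exact (IH (shift a)).
Qed.

Lemma sq_subst_odd a n : sq_subst a (2 * n + 1) = 0.
Proof.
  revert a; induction n as [|n IH]; intro a; [reflexivity|].
  replace (2 * S n + 1)%nat with (S (S (2 * n + 1))) by lia; exact (IH (shift a)).
Qed.

Lemma even_odd_ext (a b : ps) :
  (forall n, a (2 * n)%nat = b (2 * n)%nat) ->
  (forall n, a (2 * n + 1)%nat = b (2 * n + 1)%nat) -> a = b.
Proof.
  intros H0 H1; apply functional_extensionality; intro n.
  destruct (Nat.Even_or_Odd n) as [[k ->]|[k ->]]; auto.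
Qed.

(** The factor 2 is the chain rule: $x\frac{d}{dx}\phi(x^2)=2\,(\theta\phi)(x^2)$. *)
Lemma neg_logder_sq phi u : neg_logder phi u ->
  neg_logder (sq_subst phi) (psZ 2 (sq_subst u)).
Proof.
  intros (H1 & H2 & H3); repeat split.
  - exact H1.
  - intro n; unfold psZ; apply Rmult_le_pos; [lra|].
    destruct (Nat.Even_or_Odd n) as [[k ->]|[k ->]];
      [rewrite sq_subst_even; apply H2|rewrite sq_subst_odd; lra].
  - assert (E : (psZ 2 (sq_subst u) * sq_subst phi)%ps = psZ 2 (sq_subst (u * phi)%ps)).
    { rewrite sq_subst_M, <- !psM_C; ring. }
    rewrite E; apply even_odd_ext; intro n; unfold theta, psN, psZ.
    + rewrite !sq_subst_even.
      apply (f_equal (fun a => a n)) in H3; unfold theta, psN in H3.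
      rewrite mult_INR; simpl (INR 2); lra.
    + rewrite !sq_subst_odd; ring.
Qed.

(** * Coefficientwise limits *)

Definition ps_lim (a : nat -> ps) (l : ps) : Prop :=
  forall n, is_lim_seq (fun N => a N n) (l n).

Lemma ps_lim_cst a : ps_lim (fun _ => a) a.
Proof. intro n; apply is_lim_seq_const. Qed.

Lemma ps_lim_M a b la lb : ps_lim a la -> ps_lim b lb ->
  ps_lim (fun N => a N * b N)%ps (la * lb)%ps.
Proof.
  intros Ha Hb n; revert a la Ha; induction n as [|n IH]; intros a la Ha; simpl.
  - now apply (is_lim_seq_mult' _ _ (la O) (lb O)).
  - apply (is_lim_seq_plus' _ _ (la O * lb (S n))).
    + now apply (is_lim_seq_mult' _ _ (la O) (lb (S n))).
    + apply (IH (fun N => shift (a N)) (shift la)); intro k; apply Ha.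
Qed.

Lemma ps_lim_D a b la lb : ps_lim a la -> ps_lim b lb ->
  ps_lim (fun N => a N + b N)%ps (la + lb)%ps.
Proof. intros Ha Hb n; now apply (is_lim_seq_plus' _ _ (la n) (lb n)). Qed.

Lemma ps_lim_B a b la lb : ps_lim a la -> ps_lim b lb ->
  ps_lim (fun N => a N - b N)%ps (la - lb)%ps.
Proof. intros Ha Hb n; now apply (is_lim_seq_minus' _ _ (la n) (lb n)). Qed.

Lemma ps_lim_theta a la : ps_lim a la -> ps_lim (fun N => theta (a N)) (theta la).
Proof.
  intros Ha n; apply (is_lim_seq_mult' _ _ (INR n) (la n)); auto.
  apply is_lim_seq_const.
Qed.

Lemma ps_lim_geom a la : ps_lim a la -> ps_lim (fun N => geom (a N)) (geom la).
Proof.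
  intros Ha n; unfold geom.
  assert (HX : forall k, ps_lim (fun N => psX (a N) k) (psX la k)).
  { induction k; [apply ps_lim_cst|now apply ps_lim_M]. }
  enough (E : forall k, ps_lim (fun N => psX_sum (a N) k) (psX_sum la k)) by apply E.
  induction k; [apply ps_lim_cst|].
  apply ps_lim_D; [assumption|apply (HX (S k))].
Qed.

Definition has_logder (phi : ps) : Prop := exists u, neg_logder phi u.

(** Expresses [u] through [phi] by operations that are continuous for coefficientwise limits; in
    [has_logder_lim] the convergence of the series [u] of the approximants comes from here and not
    from a hypothesis. *)
Lemma logder_formula phi u : neg_logder phi u ->
  u = (ps0 - theta phi * geom (ps1 - phi))%ps.
Proof.
  intros (H1 & _ & H3).
  assert (E : ((ps1 - (ps1 - phi)) * geom (ps1 - phi))%ps = ps1).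
  { apply geom_inv; unfold psB, ps1, psC; rewrite H1; ring. }
  rewrite H3.
  transitivity (u * ((ps1 - (ps1 - phi)) * geom (ps1 - phi)))%ps; [rewrite E|]; ring.
Qed.

Lemma has_logder_lim phi l : (forall N, has_logder (phi N)) -> ps_lim phi l ->
  has_logder l.
Proof.
  intros H Hl.
  assert (H1 : l O = 1).
  { assert (E : is_lim_seq (fun _ : nat => 1) (l O)).
    { apply is_lim_seq_ext with (2 := Hl O); intro N; now destruct (H N) as (u & ? & _). }
    apply is_lim_seq_unique in E; rewrite Lim_seq_const in E; congruence. }
  exists (ps0 - theta l * geom (ps1 - l))%ps; repeat split.
  - exact H1.
  - intro n.
    assert (E : ps_lim (fun N => ps0 - theta (phi N) * geom (ps1 - phi N))%ps
                  (ps0 - theta l * geom (ps1 - l))%ps).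
    { apply ps_lim_B; [apply ps_lim_cst|].
      apply ps_lim_M; [now apply ps_lim_theta|].
      apply ps_lim_geom, ps_lim_B; auto using ps_lim_cst. }
    apply (is_lim_seq_le (fun _ => 0) _ 0 _) with (2 := is_lim_seq_const 0) (3 := E n).
    intro N; destruct (H N) as (u & Hu).
    rewrite <- (logder_formula _ _ Hu); apply Hu.
  - assert (E : ((ps1 - (ps1 - l)) * geom (ps1 - l))%ps = ps1).
    { apply geom_inv; unfold psB, ps1, psC; rewrite H1; ring. }
    transitivity (theta l * ((ps1 - (ps1 - l)) * geom (ps1 - l)))%ps; [rewrite E|]; ring.
Qed.

(** * Pochhammer symbols $(x)_n=x(x+1)\cdots(x+n-1)$ and division by them *)

Fixpoint rf (x : R) (n : nat) : R :=
  match n with O => 1 | S k => rf x k * (x + INR k) end.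

Lemma rf_pos x n : 0 < x -> 0 < rf x n.
Proof.
  intro Hx; induction n; simpl; [lra|].
  apply Rmult_lt_0_compat; [assumption|]; pose proof (pos_INR n); lra.
Qed.

Lemma rf_add x n k : rf x (n + k) = rf x n * rf (x + INR n) k.
Proof.
  induction k as [|k IH].
  - rewrite Nat.add_0_r; simpl; ring.
  - rewrite Nat.add_succ_r; simpl; rewrite IH, plus_INR; ring.
Qed.

(** $(a+N)_n/(a)_n=(a+n)_N/(a)_N=\prod_{j<N}\frac{a+j+n}{a+j}$, and the factor for $j$ is what [Top]
    with $s=a+j$ does to coefficient $n$. *)
Lemma has_logder_rf_ratio a phi N : 0 < a -> has_logder phi ->
  has_logder (fun n => phi n * (rf (a + INR N) n / rf a n)).
Proof.
  intros Ha H.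
  (* The two quotients come from the two ways of splitting $(a)_{n+N}$. *)
  assert (Hr : forall n, rf (a + INR N) n / rf a n = rf (a + INR n) N / rf a N).
  { intro n; assert (E := rf_add a n N); rewrite Nat.add_comm, rf_add in E.
    pose proof (rf_pos a n Ha); pose proof (rf_pos a N Ha).
    apply Rmult_eq_reg_r with (rf a n * rf a N); [|nra].
    field_simplify; [|lra|lra]; lra. }
  replace (fun n => phi n * (rf (a + INR N) n / rf a n))
    with (fun n => phi n * (rf (a + INR n) N / rf a N))
    by (apply functional_extensionality; intro n; now rewrite Hr).
  clear Hr; induction N as [|N IH].
  - replace (fun n => phi n * (rf (a + INR n) 0 / rf a 0)) with phi; [assumption|].
    apply functional_extensionality; intro n; simpl; field.
  - destruct IH as (u & Hu).
    assert (Hs : 0 < a + INR N) by (pose proof (pos_INR N); lra).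
    exists (u + Mser (a + INR N) u)%ps.
    replace (fun n => phi n * (rf (a + INR n) (S N) / rf a (S N)))
      with (Top (a + INR N) (fun n => phi n * (rf (a + INR n) N / rf a N)));
      [now apply neg_logder_Top|].
    apply functional_extensionality; intro n; unfold Top, psD, psZ, theta; simpl.
    pose proof (rf_pos a N Ha); field; lra.
Qed.

(** $1/(a)_n$ is the limit of $N^{-n}(a+N)_n/(a)_n$; the powers $N^{-n}$ amount to a dilation of the
    variable, which [neg_logder_sc] allows. *)
Lemma has_logder_div_rf a phi : 0 < a -> has_logder phi ->
  has_logder (fun n => phi n / rf a n).
Proof.
  intros Ha H.
  (* The sequence starts at [S N] because the dilation factor is an inverse. *)
  apply (has_logder_lim (fun N => sc (/ INR (S N)) (fun n => phi n * (rf (a + INR (S N)) n / rf a n)))).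
  - intro N; destruct (has_logder_rf_ratio a phi (S N) Ha H) as (u & Hu).
    exists (sc (/ INR (S N)) u); apply neg_logder_sc; [|assumption].
    left; apply Rinv_0_lt_compat, lt_0_INR; lia.
  - intro n; unfold sc.
    apply is_lim_seq_ext with (fun N => phi n / rf a n * (rf (a + INR (S N)) n * (/ INR (S N)) ^ n)).
    { intro N; pose proof (rf_pos a n Ha); assert (INR (S N) <> 0) by (apply not_0_INR; lia).
      generalize dependent (INR (S N)); intros x Hx; field.
      repeat split; lra. }
    replace (Finite (phi n / rf a n)) with (Finite (phi n / rf a n * 1)) by (f_equal; ring).
    apply (is_lim_seq_mult' _ _ (phi n / rf a n) 1); [apply is_lim_seq_const|].
    assert (HN : is_lim_seq (fun N => / INR (S N)) 0).
    { apply (is_lim_seq_incr_1 (fun N => / INR N)).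
      replace (Finite 0) with (Rbar_inv p_infty) by reflexivity.
      apply is_lim_seq_inv; [apply is_lim_seq_INR|discriminate]. }
    induction n as [|n IH].
    + simpl; apply is_lim_seq_ext with (fun _ => 1); [intro; ring|apply is_lim_seq_const].
    + apply is_lim_seq_ext with (fun N => (rf (a + INR (S N)) n * (/ INR (S N)) ^ n)
                                          * (1 + (a + INR n) * / INR (S N))).
      { intro N; assert (Hx : INR (S N) <> 0) by (apply not_0_INR; lia).
        generalize dependent (INR (S N)); intros x Hx; simpl rf; simpl pow.
        now field. }
      replace (Finite 1) with (Finite (1 * (1 + (a + INR n) * 0))) by (f_equal; ring).
      apply (is_lim_seq_mult' _ _ 1 (1 + (a + INR n) * 0)); [assumption|].
      apply (is_lim_seq_plus' _ _ 1); [apply is_lim_seq_const|].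
      apply (is_lim_seq_mult' _ _ (a + INR n) 0); [apply is_lim_seq_const|assumption].
Qed.

(** For $e^{-cx}$ the series [u] is the monomial $cx$: the starting point to which all the divisions
    are applied. *)
Lemma has_logder_exp c : 0 <= c -> has_logder (fun n => (- c) ^ n / INR (fact n)).
Proof.
  intro Hc; exists (fun n => match n with 1%nat => c | _ => 0 end); repeat split.
  - simpl; field.
  - intros [|[|n]]; lra.
  - apply functional_extensionality; intros [|n]; unfold theta, psN.
    + simpl; ring.
    + simpl psM.
      replace (shift _) with (psC c)
        by (apply functional_extensionality; intros [|k]; reflexivity).
      rewrite psM_Cl, fact_simpl.
      change (fact n + n * fact n)%nat with (S n * fact n)%nat.
      rewrite mult_INR; simpl pow.
      assert (Hx : INR (S n) <> 0) by (apply not_0_INR; lia).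
      generalize dependent (INR (S n)); intros x Hx; field.
      repeat split; auto using INR_fact_neq_0.
Qed.

Fixpoint prodrf (k d : R) (q n : nat) : R :=
  match q with O => 1 | S j => prodrf k d j n * rf ((k + INR j) / d) n end.

(** The multiplication formula of Gamma in Pochhammer form: the $qn$ factors are sorted by residue
    mod $q$, with $k+j+qi=q\left(\frac{k+j}{q}+i\right)$. It reduces division by $(k)_{qn}$ to $q$
    divisions by symbols of index $n$. *)
Lemma rf_mult_prodrf k q n : (0 < q)%nat ->
  rf k (q * n) = INR q ^ (q * n) * prodrf k (INR q) q n.
Proof.
  intro Hq; assert (Hq' : INR q <> 0) by (apply not_0_INR; lia).
  induction n as [|n IH].
  - rewrite Nat.mul_0_r; simpl.
    enough (E : forall j, prodrf k (INR q) j 0 = 1) by (rewrite E; ring).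
    induction j; simpl; [reflexivity|]; rewrite IHj; ring.
  - replace (q * S n)%nat with (q * n + q)%nat by lia.
    rewrite rf_add, IH, pow_add.
    (* Raising $n$ by one appends one factor to each of the $q$ residue classes; the claim treats
       the first $j$ classes. *)
    enough (E : forall j, prodrf k (INR q) j n * rf (k + INR (q * n)) j
                          = INR q ^ j * prodrf k (INR q) j (S n)).
    { rewrite !Rmult_assoc, E; ring. }
    induction j as [|j IHj]; simpl; [ring|].
    transitivity (prodrf k (INR q) j n * rf (k + INR (q * n)) j
                  * (rf ((k + INR j) / INR q) n * (k + INR (q * n) + INR j))); [ring|].
    rewrite IHj, mult_INR; field; assumption.
Qed.

Lemma has_logder_div_rf_mult phi k q : (0 < q)%nat -> 0 < k -> has_logder phi ->
  has_logder (fun n => phi n / rf k (q * n)).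
Proof.
  intros Hq Hk H; assert (Hq' : 0 < INR q) by (now apply lt_0_INR).
  assert (Hj : forall j, 0 < (k + INR j) / INR q).
  { intro j; apply Rdiv_lt_0_compat; pose proof (pos_INR j); lra. }
  assert (Hp : forall j n, 0 < prodrf k (INR q) j n).
  { induction j; intro n; simpl; [lra|]; apply Rmult_lt_0_compat; auto using rf_pos. }
  assert (E : forall j, has_logder (fun n => phi n / prodrf k (INR q) j n)).
  { induction j as [|j IH].
    - replace (fun n => phi n / prodrf k (INR q) 0 n) with phi; [assumption|].
      apply functional_extensionality; intro n; simpl; field.
    - replace (fun n => phi n / prodrf k (INR q) (S j) n)
        with (fun n => phi n / prodrf k (INR q) j n / rf ((k + INR j) / INR q) n).
      + now apply has_logder_div_rf.
      + apply functional_extensionality; intro n; simpl.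
        pose proof (Hp j n); pose proof (rf_pos _ n (Hj j)); field; lra. }
  (* The remaining factor $q^{-qn}$ is a dilation by $q^{-q}$. *)
  destruct (E q) as (u & Hu); exists (sc (/ INR q ^ q) u).
  replace (fun n => phi n / rf k (q * n))
    with (sc (/ INR q ^ q) (fun n => phi n / prodrf k (INR q) q n)).
  - apply neg_logder_sc; [|assumption].
    left; now apply Rinv_0_lt_compat, pow_lt.
  - apply functional_extensionality; intro n; unfold sc.
    rewrite rf_mult_prodrf, pow_inv, <- pow_mult by assumption.
    pose proof (Hp q n); assert (0 < INR q ^ (q * n)) by (now apply pow_lt).
    field; lra.
Qed.

(** * Absolute convergence *)

Definition nrm (a : ps) (x : R) (N : nat) : R := sum_f_R0 (fun n => Rabs (a n) * x ^ n) N.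

(** Absolute convergence at $x\ge0$, encoded by bounded partial sums: such bounds pass through
    products and comparisons without taking any limit. *)
Definition cv (a : ps) (x : R) : Prop := exists M, forall N, nrm a x N <= M.

Lemma nrm_S a x N : nrm a x (S N) = Rabs (a O) + x * nrm (shift a) x N.
Proof.
  unfold nrm; rewrite decomp_sum by lia; rewrite scal_sum; simpl pred; f_equal.
  - simpl; ring.
  - apply sum_eq; intros i _; unfold shift; simpl; ring.
Qed.

Lemma sum_f_R0_incr f N M : (forall n, 0 <= f n) -> (N <= M)%nat ->
  sum_f_R0 f N <= sum_f_R0 f M.
Proof.
  intros Hf HL; induction HL as [|k HL IH]; [lra|].
  simpl; specialize (Hf (S k)); lra.
Qed.

Lemma nrm_Sr a x N : nrm a x (S N) = nrm a x N + Rabs (a (S N)) * x ^ S N.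
Proof. reflexivity. Qed.

Lemma nrm_pos a x N : 0 <= x -> 0 <= nrm a x N.
Proof.
  intro Hx; apply cond_pos_sum; intro n.
  apply Rmult_le_pos; [apply Rabs_pos|now apply pow_le].
Qed.

Lemma nrm_incr a x N M : 0 <= x -> (N <= M)%nat -> nrm a x N <= nrm a x M.
Proof.
  intro Hx; apply sum_f_R0_incr; intro n.
  apply Rmult_le_pos; auto using Rabs_pos, pow_le.
Qed.

Lemma nrm_le a b x y N : 0 <= x -> x <= y -> (forall n, Rabs (a n) <= Rabs (b n)) ->
  nrm a x N <= nrm b y N.
Proof.
  intros Hx Hy H; apply sum_Rle; intros n _.
  apply Rmult_le_compat; auto using Rabs_pos, pow_le, pow_incr.
Qed.

Lemma nrm_D a b x N : 0 <= x -> nrm (a + b)%ps x N <= nrm a x N + nrm b x N.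
Proof.
  intro Hx; unfold nrm; rewrite <- plus_sum; apply sum_Rle; intros n _.
  rewrite <- Rmult_plus_distr_r; apply Rmult_le_compat_r; [now apply pow_le|].
  apply Rabs_triang.
Qed.

Lemma nrm_Z t a x N : nrm (psZ t a) x N = Rabs t * nrm a x N.
Proof.
  unfold nrm; rewrite scal_sum; apply sum_eq; intros n _; unfold psZ.
  rewrite Rabs_mult; ring.
Qed.

(** Each $|a_i|\,|b_j|\,x^{i+j}$ with $i+j\le N$ occurs in the product of the two partial sums. *)
Lemma nrm_M a b x N : 0 <= x -> nrm (a * b)%ps x N <= nrm a x N * nrm b x N.
Proof.
  intro Hx; revert a b; induction N as [|N IH]; intros a b.
  - unfold nrm; simpl; rewrite Rabs_mult; lra.
  - rewrite (nrm_S (a * b)%ps), (nrm_S a).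
    change (shift (a * b)%ps) with (psZ (a O) (shift b) + shift a * b)%ps.
    change ((a * b)%ps O) with (a O * b O); rewrite Rabs_mult.
    pose proof (nrm_D (psZ (a O) (shift b)) (shift a * b)%ps x N Hx) as H1.
    rewrite nrm_Z in H1; pose proof (IH (shift a) b) as H2.
    assert (H3 : nrm b x N <= nrm b x (S N)) by (apply nrm_incr; auto).
    pose proof (nrm_pos (shift a) x N Hx) as H4.
    assert (H5 : nrm (shift a) x N * nrm b x N <= nrm (shift a) x N * nrm b x (S N))
      by (now apply Rmult_le_compat_l).
    pose proof (nrm_S b x N) as H6.
    assert (x * nrm (psZ (a O) (shift b) + shift a * b)%ps x N
            <= x * (Rabs (a O) * nrm (shift b) x N + nrm (shift a) x N * nrm b x (S N)))
      by (apply Rmult_le_compat_l; lra).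
    nra.
Qed.

Lemma cv_D a b x : 0 <= x -> cv a x -> cv b x -> cv (a + b)%ps x.
Proof.
  intros Hx (M & HM) (M' & HM'); exists (M + M'); intro N.
  pose proof (nrm_D a b x N Hx); specialize (HM N); specialize (HM' N); lra.
Qed.

Lemma cv_Z t a x : cv a x -> cv (psZ t a) x.
Proof.
  intros (M & HM); exists (Rabs t * M); intro N; rewrite nrm_Z.
  apply Rmult_le_compat_l; [apply Rabs_pos|apply HM].
Qed.

Lemma cv_M a b x : 0 <= x -> cv a x -> cv b x -> cv (a * b)%ps x.
Proof.
  intros Hx (M & HM) (M' & HM'); exists (M * M'); intro N.
  eapply Rle_trans; [now apply nrm_M|].
  apply Rmult_le_compat; auto using nrm_pos.
Qed.

Lemma cv_le a b x y : 0 <= x -> x <= y -> (forall n, Rabs (a n) <= Rabs (b n)) ->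
  cv b y -> cv a x.
Proof.
  intros Hx Hy H (M & HM); exists M; intro N.
  eapply Rle_trans; [now apply (nrm_le a b x y)|apply HM].
Qed.

Lemma cv_C t x : cv (psC t) x.
Proof.
  exists (Rabs t); intro N; induction N as [|N IH].
  - unfold nrm; simpl; lra.
  - rewrite nrm_Sr; simpl psC; rewrite Rabs_R0; lra.
Qed.

Lemma cv_B a b x : 0 <= x -> cv a x -> cv b x -> cv (a - b)%ps x.
Proof.
  intros Hx Ha Hb.
  replace (a - b)%ps with (a + psC (-1) * b)%ps.
  - apply cv_D, cv_M; auto using cv_C.
  - rewrite psM_C; apply functional_extensionality; intro n; unfold psD, psB, psZ; ring.
Qed.

(** Mean value bounds for $t^{n+1}$ on $[y,x]$. This one pays for the factor $n+1$ of a derivative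
    with a smaller radius; [pow_diff_upper] serves for Lipschitz estimates. *)
Lemma pow_diff_lower x y n : 0 <= y <= x -> INR (S n) * y ^ n * (x - y) <= x ^ S n - y ^ S n.
Proof.
  intros H; induction n as [|n IH]; [simpl; lra|].
  rewrite S_INR; set (k := INR (S n)) in *; change (y ^ S n) with (y * y ^ n) in *.
  change (x ^ S (S n)) with (x * x ^ S n); change (y ^ S (S n)) with (y * (y * y ^ n)).
  assert (0 <= y ^ n) by (apply pow_le; lra).
  assert (Hk : 0 <= k) by apply pos_INR.
  assert (y * (k * y ^ n * (x - y)) <= x * (x ^ S n - y * y ^ n)).
  { apply Rmult_le_compat; try lra.
    apply Rmult_le_pos; [|lra]; now apply Rmult_le_pos. }
  nra.
Qed.

Lemma pow_diff_upper x y n : 0 <= y <= x -> x ^ S n - y ^ S n <= INR (S n) * x ^ n * (x - y).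
Proof.
  intros H; induction n as [|n IH]; [simpl; lra|].
  rewrite S_INR; set (k := INR (S n)) in *; change (x ^ S n) with (x * x ^ n) in *.
  change (y ^ S (S n)) with (y * y ^ S n); change (x ^ S (S n)) with (x * (x * x ^ n)).
  assert (0 <= y ^ S n) by (apply pow_le; lra).
  assert (y ^ S n <= x * x ^ n) by (apply (pow_incr y x (S n)); lra).
  assert (x * (x * x ^ n - y ^ S n) <= x * (k * x ^ n * (x - y)))
    by (apply Rmult_le_compat_l; lra).
  nra.
Qed.

(** The derivative: its coefficients $(n+1)a_{n+1}$ are convertible to those of [PS_derive]. *)
Definition dps (a : ps) : ps := shift (theta a).

Lemma cv_dps a x y : 0 <= y < x -> cv a x -> cv (dps a) y.
Proof.
  intros Hxy (M & HM); exists (M / (x - y)); intro N.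
  apply Rmult_le_reg_r with (x - y); [lra|].
  unfold Rdiv; rewrite Rmult_assoc, Rinv_l, Rmult_1_r by lra.
  eapply Rle_trans; [|apply (HM (S N))].
  unfold nrm; rewrite (decomp_sum _ (S N)) by lia; simpl pred.
  assert (0 <= Rabs (a O) * x ^ 0) by (apply Rmult_le_pos; [apply Rabs_pos|simpl; lra]).
  enough (sum_f_R0 (fun n => Rabs (dps a n) * y ^ n) N * (x - y)
          <= sum_f_R0 (fun i => Rabs (a (S i)) * x ^ S i) N) by lra.
  rewrite Rmult_comm, scal_sum; apply sum_Rle; intros n _.
  unfold dps, shift, theta; rewrite Rabs_mult, (Rabs_pos_eq (INR (S n))) by apply pos_INR.
  pose proof (pow_diff_lower x y n ltac:(lra)).
  assert (0 <= y ^ S n) by (apply pow_le; lra).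
  assert (Rabs (a (S n)) * (INR (S n) * y ^ n * (x - y)) <= Rabs (a (S n)) * x ^ S n)
    by (apply Rmult_le_compat_l; [apply Rabs_pos|lra]).
  lra.
Qed.

Lemma cv_shift a x : 0 < x -> cv a x -> cv (shift a) x.
Proof.
  intros Hx (M & HM); exists (M / x); intro N.
  specialize (HM (S N)); rewrite nrm_S in HM.
  apply Rmult_le_reg_l with x; [lra|].
  replace (x * (M / x)) with M by (field; lra).
  pose proof (Rabs_pos (a O)); lra.
Qed.

Lemma nrm_sc a x N : 0 <= x -> nrm (sc x a) 1 N = nrm a x N.
Proof.
  intro Hx; apply sum_eq; intros n _; unfold sc.
  rewrite pow1, Rabs_mult, (Rabs_pos_eq (x ^ n)) by (now apply pow_le); ring.
Qed.

(** The dilates of [a] form a Lipschitz curve in l1, the constant being the norm of the derivative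
    at the largest radius. *)
Lemma nrm_sc_B a x y X N : 0 <= y <= x -> x <= X ->
  nrm (sc x a - sc y a)%ps 1 N <= (x - y) * nrm (dps a) X N.
Proof.
  intros Hy HX.
  assert (H0 : forall n, 0 <= X ^ n) by (intro; apply pow_le; lra).
  assert (HN : nrm (sc x a - sc y a)%ps 1 N <= nrm (sc x a - sc y a)%ps 1 (S N))
    by (apply nrm_incr; [lra|auto]).
  eapply Rle_trans; [apply HN|]; rewrite nrm_S.
  unfold psB at 1; unfold sc at 1 2; simpl pow.
  replace (a O * 1 - a O * 1) with 0 by ring; rewrite Rabs_R0.
  rewrite Rplus_0_l, Rmult_1_l; unfold nrm; rewrite scal_sum.
  apply sum_Rle; intros n _.
  unfold dps, shift, theta, psB, sc.
  rewrite pow1, Rmult_1_r, <- Rmult_minus_distr_l, !Rabs_mult.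
  rewrite (Rabs_pos_eq (INR (S n))) by apply pos_INR.
  rewrite (Rabs_pos_eq (x ^ S n - y ^ S n)).
  2:{ enough (y ^ S n <= x ^ S n) by lra; apply pow_incr; lra. }
  pose proof (pow_diff_upper x y n Hy).
  assert (x ^ n <= X ^ n) by (apply pow_incr; lra).
  assert (INR (S n) * x ^ n * (x - y) <= INR (S n) * X ^ n * (x - y)).
  { apply Rmult_le_compat_r; [lra|]; apply Rmult_le_compat_l; [apply pos_INR|assumption]. }
  assert (Rabs (a (S n)) * (x ^ S n - y ^ S n) <= Rabs (a (S n)) * (INR (S n) * X ^ n * (x - y)))
    by (apply Rmult_le_compat_l; [apply Rabs_pos|lra]).
  lra.
Qed.

(* In the l1 algebra, [A_x = A_y - A_y (psi_x - psi_y) A_x] for the rescaled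
   series, and the middle factor is small for [x] near [y]. *)
Lemma cv_inverse_open psi A y X : (psi * A)%ps = ps1 -> 0 <= y < X -> cv (dps psi) X ->
  cv A y -> exists x, y < x < X /\ cv A x.
Proof.
  intros H Hy (M & HM) (L & HL).
  assert (HM0 : 0 <= M) by (eapply Rle_trans; [|apply (HM O)]; apply nrm_pos; lra).
  assert (HL0 : 0 <= L) by (eapply Rle_trans; [|apply (HL O)]; apply nrm_pos; lra).
  assert (HML : 0 <= L * M) by (now apply Rmult_le_pos).
  (* The first bound keeps $y+d$ below $X$. The second gives $L\,d\,M\le1/2$, so that the correction
     term is absorbed into the left side and every partial sum at $y+d$ is at most $2L$. *)
  set (d := Rmin ((X - y) / 2) (/ (2 * (L * M + 1)))).
  assert (Hd1 : 0 < / (2 * (L * M + 1))) by (apply Rinv_0_lt_compat; lra).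
  assert (Hd : 0 < d) by (apply Rmin_glb_lt; lra).
  assert (Hd2 : d <= (X - y) / 2) by apply Rmin_l.
  assert (Hd3 : d * (L * M) <= / 2).
  { apply Rle_trans with (/ (2 * (L * M + 1)) * (L * M)).
    - apply Rmult_le_compat_r; [assumption|apply Rmin_r].
    - apply Rmult_le_reg_l with (2 * (L * M + 1)); [lra|].
      rewrite <- Rmult_assoc, Rinv_r by lra; lra. }
  exists (y + d); split; [lra|]; exists (2 * L); intro N.
  set (x := y + d).
  assert (Hsc1 : forall t, sc t ps1 = ps1).
  { intro t; apply functional_extensionality; intros [|n]; unfold sc, ps1, psC; simpl; ring. }
  assert (Ex : (sc x psi * sc x A)%ps = ps1) by (now rewrite <- sc_M, H).
  assert (Ey : (sc y psi * sc y A)%ps = ps1) by (now rewrite <- sc_M, H).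
  assert (E : sc x A = (sc y A + psC (-1) * (sc y A * (sc x psi - sc y psi) * sc x A))%ps).
  { assert (EC : psC (-1) = (- ps1)%ps).
    { apply functional_extensionality; intros [|n]; unfold psN, ps1, psC; ring. }
    rewrite EC.
    transitivity (sc y A - sc y A * (sc x psi * sc x A) + (sc y psi * sc y A) * sc x A)%ps;
      [rewrite Ex, Ey|]; ring. }
  assert (B : nrm (sc x A) 1 N <= L + L * (d * M) * nrm (sc x A) 1 N).
  { rewrite E at 1; eapply Rle_trans; [apply nrm_D; lra|].
    apply Rplus_le_compat; [rewrite nrm_sc; [apply HL|lra]|].
    rewrite psM_C, nrm_Z; replace (Rabs (-1)) with 1 by (rewrite Rabs_left; lra).
    rewrite Rmult_1_l.
    eapply Rle_trans; [apply nrm_M; lra|].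
    apply Rmult_le_compat_r; [apply nrm_pos; lra|].
    eapply Rle_trans; [apply nrm_M; lra|].
    apply Rmult_le_compat; try (apply nrm_pos; lra).
    - rewrite nrm_sc; [apply HL|lra].
    - eapply Rle_trans; [apply (nrm_sc_B psi x y X); unfold x; lra|].
      replace (x - y) with d by (unfold x; ring).
      apply Rmult_le_compat_l; [lra|apply HM]. }
  rewrite <- nrm_sc by (unfold x; lra).
  assert (0 <= nrm (sc x A) 1 N) by (apply nrm_pos; lra).
  assert (L * (d * M) * nrm (sc x A) 1 N <= / 2 * nrm (sc x A) 1 N)
    by (apply Rmult_le_compat_r; lra).
  lra.
Qed.

Lemma nonneg_abs a n : nonneg a -> Rabs (a n) = a n.
Proof. intro H; apply Rabs_pos_eq, H. Qed.

(* The bound [sum n A_n x^n <= C sum A_n x^n] leaves only the terms with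
   [n <= C] to control. *)
Lemma cv_theta_eq Q A x : 0 <= x -> nonneg A -> theta A = (Q * A)%ps -> cv Q x -> cv A x.
Proof.
  intros Hx HA H (C & HC).
  destruct (INR_unbounded (C + 1)) as (n0 & Hn0).
  assert (HC0 : 0 <= C) by (eapply Rle_trans; [|apply (HC O)]; now apply nrm_pos).
  assert (Hp : forall n, 0 <= A n * x ^ n) by (intro; apply Rmult_le_pos; auto using pow_le).
  assert (HN : forall N, sum_f_R0 (fun n => (INR n - C) * (A n * x ^ n)) N <= 0).
  { intro N.
    assert (E : nrm (theta A) x N = sum_f_R0 (fun n => INR n * (A n * x ^ n)) N).
    { apply sum_eq; intros n _; rewrite nonneg_abs by (now apply nonneg_theta).
      unfold theta; ring. }
    assert (E' : nrm A x N = sum_f_R0 (fun n => A n * x ^ n) N).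
    { apply sum_eq; intros n _; now rewrite nonneg_abs. }
    assert (B : nrm (theta A) x N <= C * nrm A x N).
    { rewrite H; eapply Rle_trans; [now apply nrm_M|].
      apply Rmult_le_compat_r; [now apply nrm_pos|apply HC]. }
    rewrite E, E', scal_sum in B.
    assert (S : sum_f_R0 (fun n => INR n * (A n * x ^ n)) N
      = sum_f_R0 (fun n => (INR n - C) * (A n * x ^ n)) N
        + sum_f_R0 (fun n => A n * x ^ n * C) N).
    { rewrite <- plus_sum; apply sum_eq; intros n _; ring. }
    lra. }
  exists ((C + 1) * sum_f_R0 (fun n => A n * x ^ n) n0); intro N.
  (* For $n>n_0$ the weight $n-C$ exceeds 1 by the choice of $n_0$; for $n\le n_0$ adding $C+1$
     raises it to $n+1$. *)
  assert (S1 : forall N, nrm A x N <= sum_f_R0 (fun n => (INR n - C) * (A n * x ^ n)) N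
             + (C + 1) * sum_f_R0 (fun n => if le_dec n n0 then A n * x ^ n else 0) N).
  { clear N; intro N; rewrite scal_sum, <- plus_sum; apply sum_Rle; intros n _.
    rewrite nonneg_abs by assumption; specialize (Hp n).
    destruct (le_dec n n0) as [L|L].
    - pose proof (pos_INR n); nra.
    - assert (INR n0 < INR n) by (apply lt_INR; lia); nra. }
  assert (S2 : forall N, sum_f_R0 (fun n => if le_dec n n0 then A n * x ^ n else 0) N
               <= sum_f_R0 (fun n => A n * x ^ n) n0).
  { clear N; intro N; destruct (le_dec N n0) as [L|L].
    - apply Rle_trans with (sum_f_R0 (fun n => A n * x ^ n) N).
      + apply sum_Rle; intros n Hn; destruct (le_dec n n0); [lra|lia].
      + now apply (sum_f_R0_incr (fun n => A n * x ^ n)).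
    - induction N as [|N IH]; [lia|]; rewrite tech5; cbv beta.
      destruct (le_dec (S N) n0); [lia|].
      destruct (le_dec N n0) as [L'|L'].
      + replace N with n0 by lia; rewrite Rplus_0_r.
        apply sum_Rle; intros k Hk; destruct (le_dec k n0); [lra|lia].
      + specialize (IH L'); lra. }
  specialize (S1 N); specialize (S2 N); specialize (HN N); nra.
Qed.

(** As $Q_0=0$, the equation reads $(n+1)A_{n+1}=\sum_{j\le n}Q_{j+1}A_{n-j}$, a recursion with
    nonnegative weights on earlier coefficients. *)
Lemma nonneg_of_theta Q A : A O = 1 -> nonneg Q -> Q O = 0 -> theta A = (Q * A)%ps -> nonneg A.
Proof.
  intros H1 HQ HQ0 H n; induction n as [n IH] using lt_wf_ind.
  destruct n as [|n]; [rewrite H1; lra|].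
  apply (f_equal (fun a => a (S n))) in H; unfold theta in H; simpl psM in H.
  rewrite HQ0 in H.
  (* [nonneg_M] asks for nonnegativity at all indices, while it is known only up to $n$; passing to
     the positive part changes none of the coefficients involved. *)
  assert (E : psM (shift Q) A n = psM (shift Q) (fun k => Rmax 0 (A k)) n).
  { apply psM_ext; auto; intros k Hk; rewrite Rmax_right; [reflexivity|].
    apply IH; lia. }
  assert (P : 0 <= psM (shift Q) (fun k => Rmax 0 (A k)) n).
  { apply nonneg_M; [intro; apply HQ|intro; apply Rmax_l]. }
  assert (Hn : 0 < INR (S n)) by (apply lt_0_INR; lia).
  apply Rmult_le_reg_l with (INR (S n)); [assumption|]; lra.
Qed.

Lemma is_series_cv a x : cv a x -> 0 <= x -> nonneg a ->
  is_series (fun n => a n * x ^ n) (Series (fun n => a n * x ^ n)).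
Proof.
  intros (M & HM) Hx Ha; apply Series_correct.
  destruct (ex_finite_lim_seq_incr (sum_n (fun n => a n * x ^ n)) M) as (l & Hl).
  - intro n; rewrite !sum_n_Reals; apply sum_f_R0_incr; auto.
    intro k; apply Rmult_le_pos; auto using pow_le.
  - intro n; rewrite sum_n_Reals; eapply Rle_trans; [|apply (HM n)].
    apply Req_le, sum_eq; intros k _; now rewrite nonneg_abs.
  - now exists l.
Qed.

Lemma partial_le_Series a x N : cv a x -> 0 <= x -> nonneg a ->
  nrm a x N <= Series (fun n => a n * x ^ n).
Proof.
  intros H Hx Ha; pose proof (is_series_cv a x H Hx Ha) as HS.
  assert (E : forall n, nrm a x n = sum_n (fun n => a n * x ^ n) n).
  { intro n; rewrite sum_n_Reals; apply sum_eq; intros k _; now rewrite nonneg_abs. }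
  apply (is_lim_seq_incr_compare (fun n => nrm a x n)).
  - apply is_lim_seq_ext with (2 := HS); intro n; now rewrite E.
  - intro n; apply nrm_incr; auto.
Qed.

Lemma Series_le_bound a x M : (forall N, nrm a x N <= M) -> 0 <= x -> nonneg a ->
  Series (fun n => a n * x ^ n) <= M.
Proof.
  intros H Hx Ha; pose proof (is_series_cv a x (ex_intro _ M H) Hx Ha) as HS.
  change (Rbar_le (Series (fun n => a n * x ^ n)) M).
  apply (is_lim_seq_le (sum_n (fun n => a n * x ^ n)) (fun _ => M)) with (2 := HS);
    [|apply is_lim_seq_const].
  intro n; rewrite sum_n_Reals; eapply Rle_trans; [|apply (H n)].
  apply Req_le, sum_eq; intros k _; now rewrite nonneg_abs.
Qed.

Lemma nrm_cont_bound a x y X N : 0 <= y <= x -> x <= X -> nonneg a ->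
  nrm a x N <= nrm a y N + (x - y) * nrm (dps a) X N.
Proof.
  intros Hy HX Ha; rewrite <- (nrm_sc a x), <- (nrm_sc a y) by lra.
  replace (sc x a) with (sc y a + (sc x a - sc y a))%ps at 1 by ring.
  eapply Rle_trans; [apply nrm_D; lra|].
  apply Rplus_le_compat_l; now apply nrm_sc_B.
Qed.

(* [nrm a x N] is monotone in [x] and continuous, so the set below is a
   compact interval. *)
Lemma nrm_max_point a t : nonneg a -> a O = 0 -> 0 < t -> (exists m, 0 < a m) ->
  exists r, 0 <= r /\ (forall N, nrm a r N <= t) /\
    forall x, r < x -> exists N, t < nrm a x N.
Proof.
  intros Ha H0 Ht (m & Hm).
  set (Y := fun x => 0 <= x /\ forall N, nrm a x N <= t).
  destruct m as [|m]; [lra|].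
  assert (Hb : bound Y).
  { exists (1 + t / a (S m)); intros x (Hx & Hx').
    specialize (Hx' (S m)); rewrite nrm_Sr in Hx'.
    assert (0 <= nrm a x m) by (now apply nrm_pos).
    rewrite (nonneg_abs a (S m)) in Hx' by assumption.
    assert (0 < t / a (S m)) by (now apply Rdiv_lt_0_compat).
    destruct (Rle_dec x 1); [lra|].
    assert (x <= x ^ S m).
    { simpl; rewrite <- (Rmult_1_r x) at 1; apply Rmult_le_compat_l; [lra|].
      apply pow_R1_Rle; lra. }
    enough (x <= t / a (S m)) by lra.
    apply Rmult_le_reg_l with (a (S m)); [assumption|].
    replace (a (S m) * (t / a (S m))) with t by (field; lra); nra. }
  assert (HY0 : Y 0).
  { split; [lra|]; intro N; apply Rle_trans with 0; [|lra].
    apply Req_le; induction N as [|N IH].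
    - unfold nrm; simpl; rewrite H0, Rabs_R0; ring.
    - rewrite nrm_Sr, IH; simpl; ring. }
  destruct (completeness Y Hb (ex_intro _ 0 HY0)) as (r & Hr1 & Hr2).
  assert (Hr : 0 <= r) by (now apply Hr1).
  exists r; repeat split; [assumption| |].
  - intro N; apply Rnot_lt_le; intro Hlt.
    set (D := nrm (dps a) r N).
    assert (HD : 0 <= D) by (now apply nrm_pos).
    (* Within [e] of the supremum the Lipschitz bound costs at most half of the supposed excess over
       [t]. *)
    set (e := (nrm a r N - t) / (2 * (D + 1))).
    assert (He : 0 < e) by (apply Rdiv_lt_0_compat; lra).
    assert (Hex : exists y, Y y /\ r - e < y).
    { apply NNPP; intro HH.
      assert (r <= r - e); [|lra].
      apply Hr2; intros y Hy; apply Rnot_lt_le; intro; apply HH; eauto. }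
    destruct Hex as (y & HYy & Hy).
    assert (y <= r) by (now apply Hr1); destruct HYy as (Hy0 & HyN).
    specialize (HyN N).
    pose proof (nrm_cont_bound a r y r N ltac:(lra) ltac:(lra) Ha) as B.
    fold D in B.
    assert ((r - y) * D <= e * D) by (apply Rmult_le_compat_r; lra).
    assert (e * (2 * (D + 1)) = nrm a r N - t) by (unfold e; field; lra).
    nra.
  - intros x Hx; apply NNPP; intro HH.
    assert (x <= r); [|lra].
    apply Hr1; split; [lra|]; intro N; apply Rnot_lt_le; intro; apply HH; eauto.
Qed.

(** One positive coefficient of positive degree opens a gap that is present in all partial sums from
    that degree on, hence survives in the limit. *)
Lemma Series_strict a x y : cv a y -> 0 <= x < y -> nonneg a -> a O = 0 -> (exists m, 0 < a m) ->
  Series (fun n => a n * x ^ n) < Series (fun n => a n * y ^ n).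
Proof.
  intros Hc Hx Ha H0 (m & Hm); destruct m as [|m]; [lra|].
  assert (Hcx : cv a x) by (apply (cv_le a a x y); auto using Rle_refl; lra).
  assert (B : Series (fun n => a n * x ^ n)
              <= Series (fun n => a n * y ^ n) - a (S m) * (y ^ S m - x ^ S m)).
  { apply Series_le_bound; auto; try lra; intro N.
    assert (P : forall N, nrm a x N + (if le_dec (S m) N then a (S m) * (y ^ S m - x ^ S m) else 0)
              <= nrm a y N).
    { clear N; intro N.
      assert (Hp : forall n, Rabs (a n) * x ^ n <= Rabs (a n) * y ^ n).
      { intro n; apply Rmult_le_compat_l; [apply Rabs_pos|apply pow_incr; lra]. }
      induction N as [|N IH].
      - destruct (le_dec (S m) 0); [lia|]; unfold nrm; simpl; lra.
      - rewrite !nrm_Sr.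
        destruct (le_dec (S m) N); destruct (le_dec (S m) (S N)); try lia.
        + specialize (Hp (S N)); lra.
        + assert (m = N) by lia; subst m; rewrite (nonneg_abs a (S N)) by assumption; lra.
        + specialize (Hp (S N)); lra. }
    specialize (P (max N (S m))).
    destruct (le_dec (S m) (max N (S m))); [|lia].
    pose proof (partial_le_Series a y (max N (S m)) Hc ltac:(lra) Ha).
    pose proof (nrm_incr a x N (max N (S m)) ltac:(lra) ltac:(lia)); lra. }
  assert (x ^ S m < y ^ S m).
  { pose proof (pow_diff_lower y x m ltac:(lra)) as B'.
    (* At $x=0$ the mean value bound may degenerate to 0. *)
    destruct (Req_dec x 0) as [->|Hx0].
    - rewrite pow_i by lia; apply pow_lt; lra.
    - assert (0 < INR (S m) * x ^ m * (y - x)); [|lra].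
      apply Rmult_lt_0_compat; [|lra]; apply Rmult_lt_0_compat;
        [apply lt_0_INR; lia|apply pow_lt; lra]. }
  nra.
Qed.

(** * Entire series and the solution of k(r) = t *)

Definition entire (a : ps) : Prop := forall x, 0 <= x -> cv a x.

Lemma entire_dps a : entire a -> entire (dps a).
Proof. intros H x Hx; apply (cv_dps a (x + 1)); [lra|apply H; lra]. Qed.

Lemma cv_theta a x y : 0 <= x < y -> cv a y -> cv (theta a) x.
Proof.
  intros Hx H; destruct (cv_dps a y x Hx H) as (M & HM).
  exists (x * M); intros [|N].
  - unfold nrm, theta; simpl; rewrite Rmult_0_l, Rabs_R0.
    assert (0 <= M) by (eapply Rle_trans; [|apply (HM O)]; now apply nrm_pos).
    rewrite Rmult_0_l; now apply Rmult_le_pos.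
  - rewrite nrm_S; unfold theta at 1; simpl INR; rewrite Rmult_0_l, Rabs_R0, Rplus_0_l.
    apply Rmult_le_compat_l; [lra|apply HM].
Qed.

Lemma entire_theta a : entire a -> entire (theta a).
Proof. intros H x Hx; apply (cv_theta a x (x + 1)); [lra|apply H; lra]. Qed.

(** For $F=z\phi^{1/s}$ one has $F'=\phi^{1/s}(1-u/s)$; the two summands are the contributions of
    these two factors to $-zF''/F'$. *)
Definition Kser (s : R) (u : ps) : ps := (psZ (/ s) u + Mser s u)%ps.

Lemma Kser_0 s u : u O = 0 -> Kser s u O = 0.
Proof.
  intro H; unfold Kser, Mser, geom, psD, psZ, theta; simpl; rewrite H; ring.
Qed.

Lemma nonneg_Kser s u : 0 < s -> nonneg u -> nonneg (Kser s u).
Proof.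
  intros Hs Hu; assert (0 < / s) by (now apply Rinv_0_lt_compat).
  apply nonneg_D; [apply nonneg_Z; auto; lra|now apply nonneg_Mser].
Qed.

(** If [u] vanished, [phi] would be constant. *)
Lemma Kser_pos_coef s phi u : 0 < s -> neg_logder phi u -> (exists n, phi (S n) <> 0) ->
  exists m, 0 < Kser s u m.
Proof.
  intros Hs (_ & Hu & H) (n1 & Hn1).
  assert (His : 0 < / s) by (now apply Rinv_0_lt_compat).
  destruct (classic (exists m, 0 < u m)) as [(m & Hm)|N].
  - exists m; unfold Kser, psD, psZ; pose proof (nonneg_Mser s u Hs Hu m).
    assert (0 < / s * u m) by (now apply Rmult_lt_0_compat); lra.
  - exfalso; assert (Eu : u = ps0).
    { apply functional_extensionality; intro n; unfold ps0.
      destruct (Rle_lt_or_eq_dec 0 (u n) (Hu n)) as [L|L]; [exfalso; eauto|auto]. }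
    subst u; apply (f_equal (fun a => a (S n1))) in H.
    unfold theta, psN in H; rewrite psM_0l in H.
    assert (INR (S n1) <> 0) by (apply not_0_INR; lia).
    apply Hn1; apply Rmult_eq_reg_l with (INR (S n1)); lra.
Qed.

Lemma entire_Top s phi : entire phi -> entire (Top s phi).
Proof. intros H x Hx; apply cv_D; auto; apply cv_Z; now apply entire_theta. Qed.

(** The point [r] is the largest one at which all partial sums of $k$ are at most [t]. A priori it
    could be the radius of convergence, with $k(r)<t$ and divergence beyond; a radius $R'>r$ at
    which $k$ still converges excludes this. Convergence travels from $k$ to $Q$ to $A$ at [r], and
    from $A$ back to $Q$ and $k$ at $R'$. The inverse [A] is part of the conclusion since its
    convergence will yield nonvanishing. *)
Lemma convexity_root phi u s t : entire phi -> neg_logder phi u -> (exists n, phi (S n) <> 0) ->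
  0 < s -> 0 < t ->
  exists r R', 0 < r < R' /\ cv (Kser s u) R' /\
    Series (fun n => Kser s u n * r ^ n) = t /\
    exists A, (phi * (ps1 - psZ (/ s) u) * A)%ps = ps1 /\ cv A R'.
Proof.
  intros He H Hn Hs Ht.
  pose proof (neg_logder_u0 _ _ H) as Hu0.
  assert (Hu : nonneg u) by apply H.
  assert (Hm : nonneg (Mser s u)) by (now apply nonneg_Mser).
  assert (His : 0 < / s) by (now apply Rinv_0_lt_compat).
  assert (Hk : nonneg (Kser s u)) by (now apply nonneg_Kser).
  assert (Hm0 : Mser s u O = 0) by (unfold Mser, geom, psZ, theta; simpl; ring).
  assert (Hk0 : Kser s u O = 0) by (now apply Kser_0).
  assert (Hkpos : exists m, 0 < Kser s u m) by (now apply Kser_pos_coef with phi).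
  set (psi := Top s phi).
  pose proof (neg_logder_Top s phi u Hs H) as Hpsi; fold psi in Hpsi.
  set (Q := (u + Mser s u)%ps) in *.
  assert (HQ : nonneg Q) by apply Hpsi.
  set (A := geom (ps1 - psi)%ps).
  assert (Hpsi0 : psi O = 1) by apply Hpsi.
  assert (HA : (psi * A)%ps = ps1).
  { unfold A; replace psi with (ps1 - (ps1 - psi))%ps at 1 by ring.
    apply geom_inv; unfold psB, ps1, psC; rewrite Hpsi0; ring. }
  assert (HA0 : A O = 1).
  { apply (f_equal (fun a => a O)) in HA; simpl in HA; rewrite Hpsi0 in HA; lra. }
  assert (HtA : theta A = (Q * A)%ps).
  { assert (E : (theta psi * A + psi * theta A)%ps = ps0)
      by (rewrite <- theta_M, HA; apply theta_1).
    destruct Hpsi as (_ & _ & Hpsi); rewrite Hpsi in E.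
    transitivity ((psi * A) * theta A)%ps; [rewrite HA; ring|].
    transitivity (A * (- (Q * psi) * A + psi * theta A) + (psi * A) * (Q * A))%ps; [ring|].
    rewrite E, HA; ring. }
  assert (HAn : nonneg A).
  { apply (nonneg_of_theta Q); auto; unfold Q, psD; rewrite Hu0, Hm0; ring. }
  assert (Hepsi : entire psi) by (now apply entire_Top).
  (* [k <= (1 + 1/s) Q] and [Q <= (1 + s) k] *)
  assert (HQk : forall x, 0 <= x -> cv (Kser s u) x -> cv Q x).
  { intros x Hx Hc; apply (cv_le Q (psZ (1 + s) (Kser s u)) x x); auto using cv_Z; [lra|].
    intro n; rewrite !nonneg_abs; auto; [|apply nonneg_Z; auto; lra].
    unfold Q, Kser, psZ, psD.
    replace ((1 + s) * (/ s * u n + Mser s u n))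
      with (u n + Mser s u n + (/ s * u n + s * Mser s u n)) by (field; lra).
    specialize (Hu n); specialize (Hm n).
    assert (0 <= / s * u n) by (apply Rmult_le_pos; lra).
    assert (0 <= s * Mser s u n) by (apply Rmult_le_pos; lra); lra. }
  assert (HkQ : forall x, 0 <= x -> cv Q x -> cv (Kser s u) x).
  { intros x Hx Hc; apply (cv_le (Kser s u) (psZ (1 + / s) Q) x x); auto using cv_Z; [lra|].
    intro n; rewrite !nonneg_abs; auto; [|apply nonneg_Z; auto; lra].
    unfold Q, Kser, psZ, psD; specialize (Hu n); specialize (Hm n).
    assert (0 <= / s * Mser s u n) by (apply Rmult_le_pos; lra); lra. }
  destruct (nrm_max_point (Kser s u) t Hk Hk0 Ht Hkpos) as (r & Hr & Hr1 & Hr2).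
  assert (HAr : cv A r).
  { apply (cv_theta_eq Q); auto; apply HQk; auto; now exists t. }
  destruct (cv_inverse_open psi A r (r + 1) HA ltac:(lra)) as (R' & HR' & HAR); auto.
  { now apply entire_dps; [|lra]. }
  (* The way back: $\theta\psi=-Q\psi$ and $\psi A=1$ give $Q=-(\theta\psi)A$, with $\psi$
     entire. *)
  assert (HkR : cv (Kser s u) R').
  { apply HkQ; [lra|].
    replace Q with ((psC (-1) * theta psi) * A)%ps.
    - apply cv_M; [lra| |assumption]; apply cv_M; [lra|apply cv_C|].
      now apply entire_theta; [|lra].
    - destruct Hpsi as (_ & _ & Hpsi); rewrite Hpsi, psM_C.
      replace (psZ (-1) (- (Q * psi))%ps) with (Q * psi)%ps.
      + transitivity (Q * (psi * A))%ps; [|rewrite HA]; ring.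
      + apply functional_extensionality; intro n; unfold psZ, psN; ring. }
  (* If $k(r)<t$, the bound on $k'$ at the midpoint of $r$ and $R'$ keeps all partial sums at most
     [t] slightly beyond [r], against maximality. *)
  assert (Hser : Series (fun n => Kser s u n * r ^ n) = t).
  { apply Rle_antisym; [now apply Series_le_bound|].
    apply Rnot_lt_le; intro Hlt; set (S0 := Series _) in Hlt.
    destruct (cv_dps (Kser s u) R' ((r + R') / 2) ltac:(lra) HkR) as (D & HD).
    assert (HD0 : 0 <= D) by (eapply Rle_trans; [|apply (HD O)]; apply nrm_pos; lra).
    set (e := Rmin ((R' - r) / 2) ((t - S0) / (D + 1))).
    assert (He1 : 0 < (t - S0) / (D + 1)) by (apply Rdiv_lt_0_compat; lra).
    assert (He0 : 0 < e) by (apply Rmin_glb_lt; lra).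
    assert (He2 : e <= (R' - r) / 2) by apply Rmin_l.
    assert (He3 : e * (D + 1) <= t - S0).
    { replace (t - S0) with ((t - S0) / (D + 1) * (D + 1)) by (field; lra).
      apply Rmult_le_compat_r; [lra|apply Rmin_r]. }
    destruct (Hr2 (r + e) ltac:(lra)) as (N & HN).
    pose proof (nrm_cont_bound (Kser s u) (r + e) r ((r + R') / 2) N ltac:(lra) ltac:(lra) Hk).
    pose proof (partial_le_Series (Kser s u) r N (ex_intro _ t Hr1) Hr Hk) as P.
    fold S0 in P.
    assert ((r + e - r) * nrm (dps (Kser s u)) ((r + R') / 2) N <= e * D).
    { replace (r + e - r) with e by ring; apply Rmult_le_compat_l; [lra|apply HD]. }
    lra. }
  exists r, R'; repeat split; auto; try lra.
  (* At 0 the series has the value 0, which is less than [t]. *)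
  - destruct (Req_dec r 0) as [E|E]; [|lra]; exfalso.
    assert (Hle : Series (fun n => Kser s u n * r ^ n) <= 0); [|lra].
    apply Series_le_bound; auto; intro N.
    subst r; apply Req_le; induction N as [|N IH].
    + unfold nrm; simpl; rewrite Hk0, Rabs_R0; ring.
    + rewrite nrm_Sr, IH; simpl; ring.
  - exists A; split; auto; rewrite <- (Top_fact s phi u H); exact HA.
Qed.

(** * The Gamma function *)

Definition gamma_int (x t : R) : R := Rpower t (x - 1) * exp (- t).

Lemma gamma_int_pos x t : 0 < gamma_int x t.
Proof. apply Rmult_lt_0_compat; apply exp_pos. Qed.

Lemma gamma_int_cont x t : 0 < t -> continuous (gamma_int x) t.
Proof.
  intro Ht; apply (@ex_derive_continuous R_AbsRing R_NormedModule); unfold gamma_int, Rpower.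
  auto_derive; assumption.
Qed.

Lemma gamma_int_ex x a b : 0 < a -> 0 < b -> ex_RInt (gamma_int x) a b.
Proof.
  intros Ha Hb; apply (@ex_RInt_continuous R_CompleteNormedModule); intros t Ht; apply gamma_int_cont.
  apply Rlt_le_trans with (2 := proj1 Ht); now apply Rmin_pos.
Qed.

Lemma exp_monotone x y : x <= y -> exp x <= exp y.
Proof. intros [H| ->]; [left; now apply exp_increasing|apply Rle_refl]. Qed.

(* [ln t <= ln (2 y) + t / (2 y) - 1] *)
Lemma Rpower_exp_bound y : 0 < y -> exists M, 0 < M /\
  forall t, 0 < t -> Rpower t y * exp (- t) <= M * exp (- t / 2).
Proof.
  intro Hy; exists (exp (y * (ln (2 * y) - 1))); split; [apply exp_pos|].
  intros t Ht; unfold Rpower; rewrite <- !exp_plus.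
  apply exp_monotone.
  assert (H : ln (t / (2 * y)) <= t / (2 * y) - 1).
  { assert (0 < t / (2 * y)) by (apply Rdiv_lt_0_compat; lra).
    pose proof (exp_ineq1_le (ln (t / (2 * y)))) as He; rewrite exp_ln in He; lra. }
  unfold Rdiv in H at 1; rewrite ln_mult, ln_Rinv in H; try lra;
    [|apply Rinv_0_lt_compat; lra].
  assert (B : y * ln t <= y * (ln (2 * y) + (t / (2 * y) - 1)))
    by (apply Rmult_le_compat_l; lra).
  replace (y * (ln (2 * y) + (t / (2 * y) - 1)))
    with (y * (ln (2 * y) - 1) + t / 2) in B by (field; lra).
  lra.
Qed.

Lemma gamma_int_bounded x : 1 < x -> exists M, forall a b, 0 < a <= b ->
  RInt (gamma_int x) a b <= M.
Proof.
  intro Hx; destruct (Rpower_exp_bound (x - 1)) as (M & HM0 & HM); [lra|].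
  exists (2 * M); intros a b Hab.
  assert (E : is_RInt (fun t => M * exp (- t / 2)) a b
                (- 2 * M * exp (- b / 2) - - 2 * M * exp (- a / 2))).
  { apply (@is_RInt_derive R_CompleteNormedModule (fun t => - 2 * M * exp (- t / 2))).
    - intros t _; auto_derive; [trivial|]; field_simplify; try lra.
    - intros t _; apply (@ex_derive_continuous R_AbsRing R_NormedModule).
      auto_derive; trivial. }
  apply Rle_trans with (RInt (fun t => M * exp (- t / 2)) a b).
  - apply RInt_le; [lra|apply gamma_int_ex; lra|eexists; exact E|].
    intros t Ht; apply HM; lra.
  - rewrite (is_RInt_unique _ _ _ _ E).
    pose proof (exp_pos (- b / 2)).
    assert (exp (- a / 2) <= 1) by (rewrite <- exp_0; apply exp_monotone; lra).
    nra.
Qed.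

(** The integrand is positive, so the integrals over $[a,b]$ grow with the interval and their
    supremum is the improper integral; $1<x$ lets one exponential bound serve near 0 and near
    infinity alike. *)
Lemma gamma_conv_large x : 1 < x -> exists l, 0 < l /\
  is_RInt_gen (gamma_int x) (at_right 0) (Rbar_locally p_infty) l.
Proof.
  intro Hx; destruct (gamma_int_bounded x Hx) as (M & HM).
  set (S := fun v => exists a b, 0 < a <= b /\ v = RInt (gamma_int x) a b).
  assert (Hb : bound S).
  { exists M; intros v (a & b & Hab & ->); now apply HM. }
  destruct (completeness S Hb) as (l & Hl1 & Hl2).
  { exists (RInt (gamma_int x) 1 1), 1, 1; split; [lra|reflexivity]. }
  exists l; split.
  - apply Rlt_le_trans with (RInt (gamma_int x) 1 2).
    + apply RInt_gt_0; [lra| |].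
      * intros; apply gamma_int_pos.
      * intros; apply gamma_int_cont; lra.
    + apply Hl1; exists 1, 2; split; [lra|reflexivity].
  - apply filterlimi_locally; intro eps.
    assert (Hex : exists v, S v /\ l - eps < v).
    { apply NNPP; intro HH; pose proof (cond_pos eps).
      assert (l <= l - eps); [|lra].
      apply Hl2; intros v Hv; apply Rnot_lt_le; intro; apply HH; eauto. }
    destruct Hex as (v & (a & b & Hab & ->) & Hv).
    exists (fun a' => 0 < a' <= a) (fun b' => b <= b').
    + exists (mkposreal a (proj1 Hab)); intros y Hy Hy0; simpl in Hy.
      unfold ball in Hy; simpl in Hy; unfold AbsRing_ball, abs, minus, plus, opp in Hy; simpl in Hy.
      split; [assumption|]; rewrite Rabs_pos_eq in Hy; lra.
    + exists b; intros; lra.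
    + intros a' b' Ha' Hb'; exists (RInt (gamma_int x) a' b'); split.
      { apply (@RInt_correct R_CompleteNormedModule), gamma_int_ex; simpl; lra. }
      assert (RInt (gamma_int x) a' b' <= l).
      { apply Hl1; exists a', b'; split; [lra|reflexivity]. }
      assert (RInt (gamma_int x) a b <= RInt (gamma_int x) a' b').
      { rewrite <- (RInt_Chasles _ a' a b'), <- (RInt_Chasles _ a b b');
          try (apply gamma_int_ex; lra).
        unfold plus; simpl.
        assert (0 <= RInt (gamma_int x) a' a).
        { apply RInt_ge_0; [lra|apply gamma_int_ex; lra|].
          intros; left; apply gamma_int_pos. }
        assert (0 <= RInt (gamma_int x) b b').
        { apply RInt_ge_0; [lra|apply gamma_int_ex; lra|].
          intros; left; apply gamma_int_pos. }
        lra. }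
      unfold ball; simpl; unfold AbsRing_ball, abs, minus, plus, opp; simpl.
      apply Rabs_def1; lra.
Qed.

Lemma gamma_boundary_0 x : 0 < x ->
  filterlim (fun t => Rpower t x * exp (- t)) (at_right 0) (locally 0).
Proof.
  intro Hx; apply filterlim_locally; intro eps; pose proof (cond_pos eps) as He.
  exists (mkposreal (Rpower eps (/ x)) (exp_pos _)); intros t Ht Ht0.
  unfold ball in *; simpl in *; unfold AbsRing_ball, abs, minus, plus, opp in *; simpl in *.
  rewrite Rabs_pos_eq in Ht by lra.
  rewrite Ropp_0, Rplus_0_r in *.
  rewrite Rabs_pos_eq by (left; apply Rmult_lt_0_compat; apply exp_pos).
  apply Rle_lt_trans with (Rpower t x * 1).
  - apply Rmult_le_compat_l; [left; apply exp_pos|].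
    rewrite <- exp_0; apply exp_monotone; lra.
  - rewrite Rmult_1_r; replace (pos eps) with (Rpower (Rpower eps (/ x)) x).
    + unfold Rpower at 1 2; apply exp_increasing; apply Rmult_lt_compat_l; [lra|].
      apply ln_increasing; lra.
    + rewrite Rpower_mult, Rinv_l, Rpower_1; lra.
Qed.

Lemma gamma_boundary_infty x : 0 < x ->
  filterlim (fun t => Rpower t x * exp (- t)) (Rbar_locally p_infty) (locally 0).
Proof.
  intro Hx; destruct (Rpower_exp_bound x Hx) as (M & HM0 & HM).
  apply filterlim_locally; intro eps; pose proof (cond_pos eps) as He.
  exists (Rmax 0 (- 2 * ln (eps / M))); intros t Ht.
  assert (0 < t) by (eapply Rle_lt_trans; [apply Rmax_l|exact Ht]).
  assert (- 2 * ln (eps / M) < t) by (eapply Rle_lt_trans; [apply Rmax_r|exact Ht]).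
  unfold ball; simpl; unfold AbsRing_ball, abs, minus, plus, opp; simpl.
  rewrite Ropp_0, Rplus_0_r.
  rewrite Rabs_pos_eq by (left; apply Rmult_lt_0_compat; apply exp_pos).
  eapply Rle_lt_trans; [now apply HM|].
  assert (0 < eps / M) by (now apply Rdiv_lt_0_compat).
  replace (pos eps) with (M * exp (ln (eps / M))) by (rewrite exp_ln; [field|]; lra).
  apply Rmult_lt_compat_l; [lra|]; apply exp_increasing; lra.
Qed.

(** The integrand is the derivative of $t^xe^{-t}$, which tends to 0 at both ends. *)
Lemma gamma_by_parts x : 0 < x ->
  is_RInt_gen (fun t => x * gamma_int x t - gamma_int (x + 1) t)
    (at_right 0) (Rbar_locally p_infty) 0.
Proof.
  intro Hx.
  set (F := fun t => Rpower t x * exp (- t)).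
  assert (HF : forall t, 0 < t -> is_derive F t (x * gamma_int x t - gamma_int (x + 1) t)).
  { intros t Ht; unfold F, gamma_int.
    replace (x + 1 - 1) with x by ring.
    assert (E : Rpower t (x - 1) = Rpower t x / t).
    { unfold Rminus; rewrite Rpower_plus, Rpower_Ropp, Rpower_1 by assumption; reflexivity. }
    rewrite E; unfold Rpower; auto_derive; [assumption|]; field; lra. }
  assert (Hpos : filter_prod (at_right 0) (Rbar_locally p_infty)
     (fun ab => forall t, Rmin (fst ab) (snd ab) <= t -> 0 < t)).
  { exists (fun a => 0 < a) (fun b => 0 < b).
    - now exists (mkposreal 1 Rlt_0_1).
    - now exists 0.
    - intros a b Ha Hb t Ht; apply Rlt_le_trans with (2 := Ht); now apply Rmin_pos. }
  apply (is_RInt_gen_ext (Derive F)).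
  - apply filter_imp with (2 := Hpos); intros ab Hab t Ht.
    apply is_derive_unique, HF, Hab; lra.
  - rewrite <- (Rminus_diag 0) at 2; apply is_RInt_gen_Derive.
    + apply filter_imp with (2 := Hpos); intros ab Hab t Ht.
      eexists; apply HF, Hab; lra.
    + apply filter_imp with (2 := Hpos); intros ab Hab t Ht.
      assert (Ht0 : 0 < t) by (apply Hab; lra).
      apply (continuous_ext_loc _ (fun t => x * gamma_int x t - gamma_int (x + 1) t)).
      * exists (mkposreal t Ht0); intros y Hy.
        unfold ball in Hy; simpl in Hy; unfold AbsRing_ball, abs, minus, plus, opp in Hy; simpl in Hy.
        symmetry; apply is_derive_unique, HF; apply Rabs_def2 in Hy; lra.
      * apply (@ex_derive_continuous R_AbsRing R_NormedModule); unfold gamma_int, Rpower.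
        auto_derive; auto.
    + now apply gamma_boundary_0.
    + now apply gamma_boundary_infty.
Qed.

(** Extends convergence to $0<x\le1$, where the exponential bound fails at 0, and at the same time
    gives the functional equation. *)
Lemma gamma_conv_pred x l : 0 < x ->
  is_RInt_gen (gamma_int (x + 1)) (at_right 0) (Rbar_locally p_infty) l ->
  is_RInt_gen (gamma_int x) (at_right 0) (Rbar_locally p_infty) (l / x).
Proof.
  intros Hx H.
  pose proof (is_RInt_gen_scal _ (/ x) _ (is_RInt_gen_plus _ _ _ _ (gamma_by_parts x Hx) H)) as HH.
  unfold scal, plus in HH; simpl in HH; unfold mult in HH; simpl in HH.
  replace (l / x) with (/ x * (0 + l)) by (field; lra).
  apply is_RInt_gen_ext with (2 := HH).
  apply filter_forall; intros ab t _; cbv beta.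
  match goal with |- ?a = ?b => change (@eq R a b) end; field; lra.
Qed.

Lemma gamma_conv x : 0 < x -> exists l, 0 < l /\
  is_RInt_gen (gamma_int x) (at_right 0) (Rbar_locally p_infty) l.
Proof.
  intro Hx; destruct (gamma_conv_large (x + 1)) as (l & Hl & H); [lra|].
  exists (l / x); split; [now apply Rdiv_lt_0_compat|now apply gamma_conv_pred].
Qed.

Lemma Gamma_pos x : 0 < x -> 0 < Gamma x.
Proof.
  intro Hx; destruct (gamma_conv x Hx) as (l & Hl & H).
  replace (Gamma x) with l; [assumption|].
  symmetry; exact (is_RInt_gen_unique _ _ H).
Qed.

Lemma Gamma_succ x : 0 < x -> Gamma (x + 1) = x * Gamma x.
Proof.
  intro Hx; destruct (gamma_conv (x + 1)) as (l & Hl & H); [lra|].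
  assert (E1 : Gamma (x + 1) = l) by exact (is_RInt_gen_unique _ _ H).
  assert (E2 : Gamma x = l / x) by exact (is_RInt_gen_unique _ _ (gamma_conv_pred x l Hx H)).
  rewrite E1, E2; field; lra.
Qed.

Lemma Gamma_rf x n : 0 < x -> Gamma (INR n + x) = rf x n * Gamma x.
Proof.
  intro Hx; induction n as [|n IH].
  - simpl; rewrite Rplus_0_l; ring.
  - rewrite S_INR; replace (INR n + 1 + x) with (INR n + x + 1) by ring.
    pose proof (pos_INR n); rewrite Gamma_succ by lra; rewrite IH; simpl; ring.
Qed.

(** * Complex power series *)

Lemma is_series_zero : is_series (fun _ : nat => 0) 0.
Proof.
  change (is_lim_seq (sum_n (fun _ => 0)) 0).
  apply is_lim_seq_ext with (fun _ => 0); [|apply is_lim_seq_const].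
  intro n; rewrite sum_n_Reals; induction n; simpl; lra.
Qed.

Definition is_CSeries (c : nat -> C) (l : C) : Prop :=
  is_series (fun n => Re (c n)) (Re l) /\ is_series (fun n => Im (c n)) (Im l).

Lemma is_CSeries_unique c l : is_CSeries c l -> CSeries c = l.
Proof.
  intros (H1 & H2); unfold CSeries.
  rewrite (is_series_unique _ _ H1), (is_series_unique _ _ H2).
  now destruct l.
Qed.

Lemma is_CSeries_ext c d l : (forall n, c n = d n) -> is_CSeries c l -> is_CSeries d l.
Proof.
  intros E (H1 & H2); split; [apply is_series_ext with (2 := H1)|apply is_series_ext with (2 := H2)];
    intro n; now rewrite E.
Qed.

Lemma is_CSeries_plus c d l m : is_CSeries c l -> is_CSeries d m ->
  is_CSeries (fun n => c n + d n)%C (l + m)%C.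
Proof.
  intros (H1 & H2) (H3 & H4); split.
  - exact (is_series_plus _ _ _ _ H1 H3).
  - exact (is_series_plus _ _ _ _ H2 H4).
Qed.

Lemma is_CSeries_scal w c l : is_CSeries c l -> is_CSeries (fun n => w * c n)%C (w * l)%C.
Proof.
  intros (H1 & H2); split.
  - exact (is_series_minus _ _ _ _ (is_series_scal (Re w) _ _ H1) (is_series_scal (Im w) _ _ H2)).
  - exact (is_series_plus _ _ _ _ (is_series_scal (Re w) _ _ H2) (is_series_scal (Im w) _ _ H1)).
Qed.

Lemma is_CSeries_minus c d l m : is_CSeries c l -> is_CSeries d m ->
  is_CSeries (fun n => c n - d n)%C (l - m)%C.
Proof.
  intros H1 H2; apply (is_CSeries_scal (- (1))%C) in H2.
  pose proof (is_CSeries_plus _ _ _ _ H1 H2) as H.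
  replace (l - m)%C with (l + - (1) * m)%C by ring.
  apply is_CSeries_ext with (2 := H); intro n; ring.
Qed.

Lemma is_CSeries_decr c l : is_CSeries (fun n => c (S n)) l -> is_CSeries c (c O + l)%C.
Proof.
  intros (H1 & H2); split; apply is_series_decr_1;
    [replace (plus _ _) with (Re l)|replace (plus _ _) with (Im l)]; auto;
    unfold plus, opp, Re, Im; simpl; unfold Re, Im; ring.
Qed.

Lemma Re_Im_le w : Rabs (Re w) <= Cmod w /\ Rabs (Im w) <= Cmod w.
Proof.
  split; (eapply Rle_trans; [|apply Rmax_Cmod]); [apply Rmax_l|apply Rmax_r].
Qed.

Lemma Cmod_le_double (l : C) M : Rabs (fst l) <= M -> Rabs (snd l) <= M -> Cmod l <= 2 * M.
Proof.
  intros H1 H2; eapply Rle_trans; [apply Cmod_2Rmax|].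
  assert (Hs : sqrt 2 <= 2).
  { rewrite <- (sqrt_square 2) at 2 by lra; apply sqrt_le_1_alt; lra. }
  assert (0 <= Rmax (Rabs (fst l)) (Rabs (snd l)))
    by (eapply Rle_trans; [apply Rabs_pos|apply Rmax_l]).
  apply Rmult_le_compat; auto using sqrt_pos, Rmax_lub.
Qed.

(** The factor 2 comes from bounding real and imaginary part separately; the lemma is meant for
    remainders, where a constant is harmless. *)
Lemma is_CSeries_bound c l M : is_CSeries c l -> (forall N, sum_f_R0 (fun n => Cmod (c n)) N <= M) ->
  Cmod l <= 2 * M.
Proof.
  intros (H1 & H2) HM.
  assert (B : forall (f : nat -> R) (L : R), (forall n, Rabs (f n) <= Cmod (c n)) ->
             is_series f L -> Rabs L <= M).
  { intros f L Hf HL.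
    assert (HN : forall N, Rabs (sum_n f N) <= M).
    { intro N; rewrite sum_n_Reals; eapply Rle_trans; [|apply (HM N)].
      eapply Rle_trans; [apply Rsum_abs|]; apply sum_Rle; intros; apply Hf. }
    change (Rbar_le (Rabs L) M).
    apply (is_lim_seq_le (fun N => Rabs (sum_n f N)) (fun _ => M)); auto.
    - exact (is_lim_seq_abs _ (Finite L) HL).
    - apply is_lim_seq_const. }
  apply Cmod_le_double.
  - apply (B (fun n => Re (c n))); auto; intro n; apply Re_Im_le.
  - apply (B (fun n => Im (c n))); auto; intro n; apply Re_Im_le.
Qed.

Definition ev (a : ps) (z : C) : C := CSeries (fun n => a n * z ^ n)%C.

Lemma cv_ex_series a x : 0 <= x -> cv a x -> ex_series (fun n => Rabs (a n) * x ^ n).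
Proof.
  intros Hx (M & HM); eexists; apply (is_series_cv (fun n => Rabs (a n)) x).
  - exists M; intro N; eapply Rle_trans; [|apply (HM N)].
    apply Req_le, sum_eq; intros; now rewrite Rabs_Rabsolu.
  - assumption.
  - intro n; apply Rabs_pos.
Qed.

Lemma ev_abs a z : cv a (Cmod z) ->
  ex_series (fun n => Rabs (Re (a n * z ^ n)%C)) /\ ex_series (fun n => Rabs (Im (a n * z ^ n)%C)).
Proof.
  intro H; assert (E := cv_ex_series a _ (Cmod_ge_0 z) H).
  assert (B : forall n, Rabs (a n) * Cmod z ^ n = Cmod (a n * z ^ n)%C)
    by (intro n; now rewrite Cmod_mult, Cmod_R, Cmod_pow).
  split; apply (@ex_series_le R_AbsRing R_CompleteNormedModule) with (2 := E);
    intro n; rewrite B; change norm with Rabs; rewrite Rabs_Rabsolu; apply Re_Im_le.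
Qed.

Lemma ev_is a z : cv a (Cmod z) -> is_CSeries (fun n => a n * z ^ n)%C (ev a z).
Proof.
  intro H; destruct (ev_abs a z H) as (H1 & H2).
  split; unfold ev, CSeries; [simpl (Re (_, _))|simpl (Im (_, _))];
    apply Series_correct, ex_series_Rabs; assumption.
Qed.

Lemma ev_D a b z : cv a (Cmod z) -> cv b (Cmod z) -> ev (a + b)%ps z = (ev a z + ev b z)%C.
Proof.
  intros Ha Hb; apply is_CSeries_unique.
  apply is_CSeries_ext with (2 := is_CSeries_plus _ _ _ _ (ev_is a z Ha) (ev_is b z Hb)).
  intro n; unfold psD; rewrite RtoC_plus; ring.
Qed.

Lemma ev_B a b z : cv a (Cmod z) -> cv b (Cmod z) -> ev (a - b)%ps z = (ev a z - ev b z)%C.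
Proof.
  intros Ha Hb; apply is_CSeries_unique.
  apply is_CSeries_ext with (2 := is_CSeries_minus _ _ _ _ (ev_is a z Ha) (ev_is b z Hb)).
  intro n; unfold psB; rewrite RtoC_minus; ring.
Qed.

Lemma ev_Z t a z : cv a (Cmod z) -> ev (psZ t a) z = (t * ev a z)%C.
Proof.
  intros Ha; apply is_CSeries_unique.
  apply is_CSeries_ext with (2 := is_CSeries_scal t _ _ (ev_is a z Ha)).
  intro n; unfold psZ; rewrite RtoC_mult; ring.
Qed.

Lemma ev_C t z : ev (psC t) z = t.
Proof.
  apply is_CSeries_unique.
  replace (RtoC t) with (psC t O * z ^ 0 + 0)%C by (simpl; ring).
  apply (is_CSeries_decr (fun n => psC t n * z ^ n)%C).
  apply is_CSeries_ext with (fun _ => RtoC 0); [intro n; simpl; ring|].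
  split; exact is_series_zero.
Qed.

Lemma ev_shift a z : 0 < Cmod z -> cv a (Cmod z) -> ev a z = (a O + z * ev (shift a) z)%C.
Proof.
  intros Hz Ha; apply is_CSeries_unique.
  replace (RtoC (a O)) with (a O * z ^ 0)%C by (simpl; ring).
  apply (is_CSeries_decr (fun n => a n * z ^ n)%C).
  apply is_CSeries_ext with
    (2 := is_CSeries_scal z _ _ (ev_is (shift a) z (cv_shift a _ Hz Ha))).
  intro n; unfold shift; rewrite Cpow_S; ring.
Qed.

Lemma psM_sum a b n : psM a b n = sum_f_R0 (fun k => a k * b (n - k)%nat) n.
Proof.
  revert a; induction n as [|n IH]; intro a; [reflexivity|].
  rewrite decomp_sum by lia; simpl psM; rewrite IH; f_equal.
Qed.

(** The real and imaginary parts are combinations of four Cauchy products of absolutely convergent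
    real series, each covered by [is_series_mult]. *)
Lemma ev_M a b z : cv a (Cmod z) -> cv b (Cmod z) -> ev (a * b)%ps z = (ev a z * ev b z)%C.
Proof.
  intros Ha Hb; apply is_CSeries_unique.
  destruct (ev_is a z Ha) as (A1 & A2), (ev_is b z Hb) as (B1 & B2).
  destruct (ev_abs a z Ha) as (A3 & A4), (ev_abs b z Hb) as (B3 & B4).
  assert (E : forall n, (psM a b n * z ^ n)%C =
    (sum_f_R0 (fun k => Re (a k * z ^ k)%C * Re (b (n - k)%nat * z ^ (n - k))%C
                       - Im (a k * z ^ k)%C * Im (b (n - k)%nat * z ^ (n - k))%C) n,
     sum_f_R0 (fun k => Re (a k * z ^ k)%C * Im (b (n - k)%nat * z ^ (n - k))%C
                       + Im (a k * z ^ k)%C * Re (b (n - k)%nat * z ^ (n - k))%C) n)).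
  { intro n; rewrite psM_sum.
    apply injective_projections.
    - change (Re (sum_f_R0 (fun k => (a k * b (n - k)%nat)%R) n * z ^ n)%C =
       sum_f_R0 (fun k => Re (a k * z ^ k)%C * Re (b (n - k)%nat * z ^ (n - k))%C
                       - Im (a k * z ^ k)%C * Im (b (n - k)%nat * z ^ (n - k))%C) n).
      rewrite re_scal_l, Rmult_comm, scal_sum; apply sum_eq; intros k Hk.
      replace (z ^ n)%C with (z ^ k * z ^ (n - k))%C
        by (rewrite <- Cpow_add_r; f_equal; lia).
      rewrite !re_scal_l, !im_scal_l.
      generalize (z ^ k)%C (z ^ (n - k))%C; intros u v; unfold Re, Im; simpl; ring.
    - change (Im (sum_f_R0 (fun k => (a k * b (n - k)%nat)%R) n * z ^ n)%C =
       sum_f_R0 (fun k => Re (a k * z ^ k)%C * Im (b (n - k)%nat * z ^ (n - k))%C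
                       + Im (a k * z ^ k)%C * Re (b (n - k)%nat * z ^ (n - k))%C) n).
      rewrite im_scal_l, Rmult_comm, scal_sum; apply sum_eq; intros k Hk.
      replace (z ^ n)%C with (z ^ k * z ^ (n - k))%C
        by (rewrite <- Cpow_add_r; f_equal; lia).
      rewrite !re_scal_l, !im_scal_l.
      generalize (z ^ k)%C (z ^ (n - k))%C; intros u v; unfold Re, Im; simpl; ring. }
  split.
  - apply is_series_ext with (2 := is_series_minus _ _ _ _
      (is_series_mult _ _ _ _ A1 B1 A3 B3) (is_series_mult _ _ _ _ A2 B2 A4 B4)).
    intro n; rewrite E; simpl (Re (_, _)); rewrite minus_sum; reflexivity.
  - apply is_series_ext with (2 := is_series_plus _ _ _ _
      (is_series_mult _ _ _ _ A1 B2 A3 B4) (is_series_mult _ _ _ _ A2 B1 A4 B3)).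
    intro n; rewrite E; simpl (Im (_, _)); rewrite plus_sum; reflexivity.
Qed.

(** * Complex differentiation of power series *)

Notation is_Cderive F z l := (is_derive (K := C_AbsRing) (V := C_NormedModule) F z l).

(** A second-order remainder is what power series and [Cexp] provide directly. *)
Lemma is_Cderive_quadratic (F : C -> C) z l M d : 0 < d ->
  (forall w, Cmod (w - z) < d -> Cmod (F w - F z - (w - z) * l)%C <= M * (Cmod (w - z) * Cmod (w - z))) ->
  is_Cderive F z l.
Proof.
  intros Hd H; split; [apply is_linear_scal_l|].
  intros x Hx; apply (@is_filter_lim_locally_unique C_AbsRing (AbsRing_NormedModule C_AbsRing)) in Hx.
  subst x; intro eps; pose proof (cond_pos eps) as He.
  assert (Hr : 0 < Rmin d (eps / (Rabs M + 1))).
  { apply Rmin_glb_lt; [assumption|]; apply Rdiv_lt_0_compat; [assumption|].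
    pose proof (Rabs_pos M); lra. }
  exists (mkposreal _ Hr); intros w Hw.
  change (Cmod (w - z) < Rmin d (eps / (Rabs M + 1))) in Hw.
  change (Cmod (F w - F z - (w - z) * l)%C <= eps * Cmod (w - z)).
  pose proof (Rmin_l d (eps / (Rabs M + 1))); pose proof (Rmin_r d (eps / (Rabs M + 1))).
  eapply Rle_trans; [apply H; lra|].
  rewrite <- Rmult_assoc; apply Rmult_le_compat_r; [apply Cmod_ge_0|].
  pose proof (Rle_abs M); pose proof (Rabs_pos M); pose proof (Cmod_ge_0 (w - z)).
  assert ((Rabs M + 1) * Cmod (w - z) <= (Rabs M + 1) * (eps / (Rabs M + 1)))
    by (apply Rmult_le_compat_l; lra).
  replace ((Rabs M + 1) * (eps / (Rabs M + 1))) with (pos eps) in * by (field; lra).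
  nra.
Qed.

(** The remainders satisfy $e_{n+1}=we_n+nz^{n-1}(w-z)^2$. The constant $n(n-1)\rho^{n-2}$ is shaped
    to match a term of the second derivative of the series. *)
Lemma pow_taylor_bound (z w : C) rho n : Cmod z <= rho -> Cmod w <= rho ->
  Cmod (w ^ S (S n) - z ^ S (S n) - (w - z) * (INR (S (S n)) * z ^ S n))%C
  <= INR (S (S n)) * INR (S n) * rho ^ n * (Cmod (w - z) * Cmod (w - z)).
Proof.
  intros Hz Hw; assert (Hr : 0 <= rho) by (eapply Rle_trans; [apply Cmod_ge_0|exact Hz]).
  set (h := Cmod (w - z)%C); assert (Hh : 0 <= h) by apply Cmod_ge_0.
  induction n as [|n IH].
  - replace (w ^ 2 - z ^ 2 - (w - z) * (INR 2 * z ^ 1))%C with ((w - z) * (w - z))%C.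
    + rewrite Cmod_mult; fold h; simpl; nra.
    + simpl INR; rewrite RtoC_plus; simpl; ring.
  - set (e := (w ^ S (S n) - z ^ S (S n) - (w - z) * (INR (S (S n)) * z ^ S n))%C) in IH.
    replace (w ^ S (S (S n)) - z ^ S (S (S n)) - (w - z) * (INR (S (S (S n))) * z ^ S (S n)))%C
      with (w * e + INR (S (S n)) * z ^ S n * ((w - z) * (w - z)))%C.
    2:{ unfold e; rewrite (S_INR (S (S n))), RtoC_plus; generalize (RtoC (INR (S (S n)))).
        intro q; rewrite !Cpow_S; ring. }
    eapply Rle_trans; [apply Cmod_triangle|].
    rewrite !Cmod_mult, Cmod_R, Cmod_pow, (Rabs_pos_eq (INR (S (S n)))) by apply pos_INR.
    fold h.
    assert (H1 : Cmod w * Cmod e <= rho * (INR (S (S n)) * INR (S n) * rho ^ n * (h * h))).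
    { apply Rmult_le_compat; auto using Cmod_ge_0. }
    assert (H2 : Cmod z ^ S n <= rho ^ S n) by (apply pow_incr; auto using Cmod_ge_0).
    assert (Hq : 0 <= INR (S (S n))) by apply pos_INR.
    assert (H3 : INR (S (S n)) * Cmod z ^ S n * (h * h) <= INR (S (S n)) * rho ^ S n * (h * h)).
    { apply Rmult_le_compat_r; [now apply Rmult_le_pos|]; now apply Rmult_le_compat_l. }
    rewrite (S_INR (S (S n))).
    assert (Hq' : INR (S n) <= INR (S (S n))) by (apply le_INR; lia).
    assert (H4 : 0 <= INR (S (S n)) * rho ^ S n * (h * h)).
    { apply Rmult_le_pos; [|now apply Rmult_le_pos]; apply Rmult_le_pos; auto using pow_le. }
    rewrite (S_INR (S n)) in *; simpl pow in *; nra.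
Qed.

Lemma ev_derive a z x : cv a x -> Cmod z < x -> is_Cderive (ev a) z (ev (dps a) z).
Proof.
  intros Ha Hz; assert (Hz0 := Cmod_ge_0 z).
  (* The radii $|z|<\rho<y<x$ leave one gap for each of the two differentiations from $x$ down to
     $\rho$, and $\rho$ bounds the nearby points [w]. *)
  set (rho := (Cmod z + x) / 2).
  set (y := (rho + x) / 2).
  assert (Hcz : forall w, Cmod w <= rho -> cv a (Cmod w)).
  { intros w Hw; apply (cv_le a a _ x); auto using Cmod_ge_0, Rle_refl; unfold rho in Hw; lra. }
  assert (Hd : cv (dps a) y) by (apply (cv_dps a x); auto; unfold y, rho; lra).
  destruct (cv_dps (dps a) y rho ltac:(unfold y, rho; lra) Hd) as (M & HM).
  assert (Hdz : cv (dps a) (Cmod z))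
    by (apply (cv_le _ (dps a) _ y); auto using Rle_refl; unfold y, rho; lra).
  apply (is_Cderive_quadratic _ z _ (2 * M) ((x - Cmod z) / 2)); [lra|].
  intros w Hw; set (h := Cmod (w - z)%C) in *; assert (Hh : 0 <= h) by apply Cmod_ge_0.
  assert (Hzr : Cmod z <= rho) by (unfold rho; lra).
  assert (Hwr : Cmod w <= rho).
  { replace w with (z + (w - z))%C by ring.
    eapply Rle_trans; [apply Cmod_triangle|]; fold h; unfold rho; lra. }
  (* The derivative series delayed by one index, so that it is subtracted degree by degree; the
     remainder terms at indices 0 and 1 then vanish. *)
  set (d := fun n => match n with O => RtoC 0 | S k => (dps a k * z ^ k)%C end).
  assert (Dd : is_CSeries d (ev (dps a) z)).
  { replace (ev (dps a) z) with (d O + ev (dps a) z)%C by (simpl; ring).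
    apply is_CSeries_decr; now apply ev_is. }
  set (e := fun n => (a n * w ^ n - a n * z ^ n - (w - z) * d n)%C).
  assert (S1 : is_CSeries e (ev a w - ev a z - (w - z) * ev (dps a) z)%C).
  { apply is_CSeries_minus; [apply is_CSeries_minus; apply ev_is; auto|].
    now apply is_CSeries_scal. }
  rewrite Rmult_assoc; apply (is_CSeries_bound _ _ (M * (h * h)) S1).
  assert (E : forall n, e (S n)
    = (a (S n) * (w ^ S n - z ^ S n - (w - z) * (INR (S n) * z ^ n)))%C).
  { intro n; unfold e, d, dps, shift, theta; rewrite RtoC_mult; ring. }
  assert (E0 : e O = RtoC 0) by (unfold e, d; simpl; ring).
  assert (E1 : e 1%nat = RtoC 0) by (rewrite E; simpl; ring).
  assert (HM0 : 0 <= M).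
  { eapply Rle_trans; [|apply (HM O)]; apply nrm_pos; unfold rho; lra. }
  assert (HMh : 0 <= M * (h * h)) by (apply Rmult_le_pos; nra).
  clearbody e; intros [|[|N]].
  - simpl; rewrite E0, Cmod_0; assumption.
  - simpl; rewrite E0, E1, Cmod_0; lra.
  - rewrite (decomp_sum _ (S (S N))), (decomp_sum _ (pred (S (S N)))) by (simpl; lia).
    rewrite E0, E1, Cmod_0, !Rplus_0_l; simpl pred.
    eapply Rle_trans; [|apply Rmult_le_compat_r; [nra|apply (HM N)]].
    unfold nrm; rewrite Rmult_comm, scal_sum; apply sum_Rle; intros n _.
    rewrite E, Cmod_mult, Cmod_R.
    unfold dps at 1; unfold shift at 1; unfold theta at 1; unfold dps, shift, theta.
    rewrite !Rabs_mult, !(Rabs_pos_eq (INR _)) by apply pos_INR.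
    pose proof (pow_taylor_bound z w rho n Hzr Hwr) as B; fold h in B.
    apply Rle_trans with (Rabs (a (S (S n))) * (INR (S (S n)) * INR (S n) * rho ^ n * (h * h))).
    + apply Rmult_le_compat_l; [apply Rabs_pos|exact B].
    + right; ring.
Qed.

(* [C_NormedModule] and [AbsRing_NormedModule C_AbsRing] carry the same norm but
   different (equivalent) uniform structures. *)
Lemma is_Cderive_AbsRing (F : C -> C) (z l : C) :
  is_Cderive F z l <-> is_derive (K := C_AbsRing) (V := AbsRing_NormedModule C_AbsRing) F z l.
Proof.
  split; intros (_ & H); (split; [apply is_linear_scal_l|exact H]).
Qed.

Lemma is_Cderive_mult (F G : C -> C) z l m : is_Cderive F z l -> is_Cderive G z m ->
  is_Cderive (fun w => F w * G w)%C z (l * G z + F z * m)%C.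
Proof.
  rewrite !is_Cderive_AbsRing; intros HF HG.
  exact (is_derive_mult (K := C_AbsRing) F G z l m HF HG Cmult_comm).
Qed.

Lemma is_Cderive_comp (F G : C -> C) z l m : is_Cderive F (G z) l -> is_Cderive G z m ->
  is_Cderive (fun w => F (G w)) z (m * l)%C.
Proof.
  rewrite !is_Cderive_AbsRing; intros HF HG.
  exact (is_derive_comp (K := C_AbsRing) (V := AbsRing_NormedModule C_AbsRing) F G z l m HF HG).
Qed.

Lemma is_Cderive_ext_disk (F G : C -> C) z l x : Cmod z < x ->
  (forall w, Cmod w < x -> F w = G w) -> is_Cderive F z l -> is_Cderive G z l.
Proof.
  intros Hz HE; apply is_derive_ext_loc.
  assert (Hp : 0 < x - Cmod z) by lra.
  exists (mkposreal _ Hp); intros w Hw; change (Cmod (w - z) < x - Cmod z) in Hw.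
  apply HE; replace w with (z + (w - z))%C by ring.
  eapply Rle_lt_trans; [apply Cmod_triangle|]; lra.
Qed.

Lemma is_Cderive_id z : is_Cderive (fun w => w) z (RtoC 1).
Proof. apply is_Cderive_AbsRing; exact (is_derive_id (K := C_AbsRing) z). Qed.

Lemma is_Cderive_const (k z : C) : is_Cderive (fun _ => k) z (RtoC 0).
Proof. exact (is_derive_const (K := C_AbsRing) (V := C_NormedModule) k z). Qed.

(** * The complex exponential *)

Lemma Cexp_plus z w : Cexp (z + w) = (Cexp z * Cexp w)%C.
Proof.
  destruct z as [x y], w as [x' y'].
  change (Cexp ((x, y) + (x', y'))%C)
    with (exp (x + x') * cos (y + y'), exp (x + x') * sin (y + y')).
  rewrite exp_plus, cos_plus, sin_plus.
  apply injective_projections; simpl; ring.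
Qed.

Lemma Cexp_0 : Cexp 0 = 1.
Proof. unfold Cexp; simpl; rewrite exp_0, cos_0, sin_0; apply injective_projections; simpl; ring. Qed.

Lemma Cexp_neq_0 z : Cexp z <> 0.
Proof.
  intro H; assert (E : (Cexp z * Cexp (- z))%C = 1).
  { rewrite <- Cexp_plus, Cplus_opp_r; apply Cexp_0. }
  rewrite H, Cmult_0_l in E; now apply C1_nz.
Qed.

(** The upper bound is $e^{-x}\ge1-x$ inverted: $e^x-1-x\le x^2/(1-x)$. *)
Lemma exp_remainder x : Rabs x <= / 2 -> 0 <= exp x - 1 - x <= 2 * (x * x).
Proof.
  intro Hx; apply Rabs_le_between in Hx.
  pose proof (exp_ineq1_le x) as H1; pose proof (exp_ineq1_le (- x)) as H2.
  split; [lra|].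
  pose proof (exp_pos x) as H3.
  assert (H4 : exp x * exp (- x) = 1)
    by (rewrite <- exp_plus, Rplus_opp_r; apply exp_0).
  assert (H5 : exp x * (1 - x) <= 1) by (rewrite <- H4; apply Rmult_le_compat_l; lra).
  nra.
Qed.

Lemma abs_sin_le y : Rabs (sin y) <= Rabs y.
Proof.
  assert (H : forall t, 0 <= t -> Rabs (sin t) <= t).
  { intros t Ht; apply Rabs_le; destruct (Rle_lt_dec t 1) as [L|L].
    - destruct (Req_dec t 0) as [->|N]; [rewrite sin_0; lra|].
      assert (0 < sin t) by (apply sin_gt_0; pose proof PI2_1; unfold PI2 in *; lra).
      pose proof (sin_lt_x t ltac:(lra)); lra.
    - pose proof (SIN_bound t); lra. }
  destruct (Rle_dec 0 y).
  - rewrite (Rabs_pos_eq y) by assumption; auto.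
  - rewrite <- (Rabs_Ropp (sin y)), <- sin_neg, <- (Rabs_Ropp y), (Rabs_pos_eq (- y)) by lra.
    apply H; lra.
Qed.

Lemma cos_remainder y : 0 <= 1 - cos y <= y * y.
Proof.
  replace y with (2 * (y / 2)) at 1 2 by field; rewrite cos_2a_sin.
  pose proof (Rsqr_le_abs_1 _ _ (abs_sin_le (y / 2))) as H; unfold Rsqr in H; nra.
Qed.

Lemma sin_remainder y : Rabs y <= 1 -> Rabs (sin y - y) <= y * y.
Proof.
  intro Hy.
  destruct (MVT_gen (fun t => sin t - t) 0 y (fun t => cos t - 1)) as (c & Hc & E).
  - intros t _; auto_derive; [trivial|ring].
  - intros t _; apply continuity_pt_minus; [apply continuity_sin|apply continuity_pt_id].
  - rewrite sin_0 in E.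
    replace (sin y - y) with ((cos c - 1) * y) by lra.
    rewrite Rabs_mult; replace (y * y) with (Rabs y * Rabs y)
      by (rewrite <- Rabs_mult; apply Rabs_pos_eq; nra).
    apply Rmult_le_compat_r; [apply Rabs_pos|].
    assert (Hcy : Rabs c <= Rabs y).
    { unfold Rmin, Rmax in Hc; destruct (Rle_dec 0 y).
      - rewrite !Rabs_pos_eq; lra.
      - rewrite !Rabs_left1; lra. }
    pose proof (cos_remainder c) as B; rewrite Rabs_left1 by lra.
    replace (c * c) with (Rabs c * Rabs c) in B
      by (rewrite <- Rabs_mult; apply Rabs_pos_eq; nra).
    pose proof (Rabs_pos c); nra.
Qed.

(* The remainder is [(e^x - 1 - x) cos y - (1 + x) (1 - cos y)
   + i ((e^x - 1) sin y + (sin y - y))]. *)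
Lemma Cexp_remainder h : Cmod h < / 2 ->
  Cmod (Cexp h - 1 - h)%C <= 8 * (Cmod h * Cmod h).
Proof.
  intro Hh; destruct (Re_Im_le h) as (Hx & Hy); set (m := Cmod h) in *.
  destruct h as [x y]; simpl in Hx, Hy.
  assert (Hxx : x * x <= m * m).
  { rewrite <- (Rabs_pos_eq (x * x)), Rabs_mult by nra; apply Rmult_le_compat; auto using Rabs_pos. }
  assert (Hyy : y * y <= m * m).
  { rewrite <- (Rabs_pos_eq (y * y)), Rabs_mult by nra; apply Rmult_le_compat; auto using Rabs_pos. }
  pose proof (exp_remainder x ltac:(lra)) as Be.
  pose proof (cos_remainder y) as Bc.
  pose proof (sin_remainder y ltac:(lra)) as Bs.
  pose proof (COS_bound y) as Hcos.
  assert (Hx' := proj1 (Rabs_le_between x m) Hx).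
  assert (Hxy : Rabs x * Rabs y <= m * m) by (apply Rmult_le_compat; auto using Rabs_pos).
  assert (Bx : Rabs (exp x - 1) <= 2 * Rabs x).
  { replace (exp x - 1) with ((exp x - 1 - x) + x) by ring.
    eapply Rle_trans; [apply Rabs_triang|].
    rewrite (Rabs_pos_eq (exp x - 1 - x)) by lra.
    assert (x * x = Rabs x * Rabs x) by (rewrite <- Rabs_mult; symmetry; apply Rabs_pos_eq; nra).
    pose proof (Rabs_pos x); nra. }
  set (r := (Cexp (x, y) - 1 - (x, y))%C).
  assert (H1 : Rabs (fst r) <= 4 * (m * m)).
  { replace (fst r) with ((exp x - 1 - x) * cos y - (1 + x) * (1 - cos y)) by (simpl; ring).
    assert (A1 : 0 <= (exp x - 1 - x) * (1 - cos y)) by (apply Rmult_le_pos; lra).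
    assert (A2 : 0 <= (exp x - 1 - x) * (1 + cos y)) by (apply Rmult_le_pos; lra).
    assert (A3 : 0 <= (1 + x) * (1 - cos y)) by (apply Rmult_le_pos; lra).
    assert (A4 : (1 + x) * (1 - cos y) <= 2 * (y * y)) by (apply Rmult_le_compat; lra).
    apply Rabs_le; split; lra. }
  assert (H2 : Rabs (snd r) <= 4 * (m * m)).
  { replace (snd r) with ((exp x - 1) * sin y + (sin y - y)) by (simpl; ring).
    eapply Rle_trans; [apply Rabs_triang|]; rewrite Rabs_mult.
    assert (Rabs (exp x - 1) * Rabs (sin y) <= 2 * Rabs x * Rabs y)
      by (apply Rmult_le_compat; auto using Rabs_pos, abs_sin_le).
    lra. }
  replace (8 * (m * m)) with (2 * (4 * (m * m))) by ring; now apply Cmod_le_double.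
Qed.

Lemma Cexp_derive z : is_Cderive Cexp z (Cexp z).
Proof.
  apply (is_Cderive_quadratic _ z _ (8 * Cmod (Cexp z)) (/ 2)); [lra|].
  intros w Hw.
  replace (Cexp w) with (Cexp z * Cexp (w - z))%C
    by (rewrite <- Cexp_plus; f_equal; ring).
  replace (Cexp z * Cexp (w - z) - Cexp z - (w - z) * Cexp z)%C
    with (Cexp z * (Cexp (w - z) - 1 - (w - z)))%C by ring.
  rewrite Cmod_mult.
  pose proof (Cexp_remainder (w - z)%C Hw).
  apply Rle_trans with (Cmod (Cexp z) * (8 * (Cmod (w - z) * Cmod (w - z)))); [|right; ring].
  apply Rmult_le_compat_l; [apply Cmod_ge_0|assumption].
Qed.

(** * Radius of convexity *)

Lemma is_series_le (f g : nat -> R) l m : (forall n, f n <= g n) ->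
  is_series f l -> is_series g m -> l <= m.
Proof.
  intros H Hf Hg; change (Rbar_le l m).
  apply (is_lim_seq_le (sum_n f) (sum_n g)); auto.
  intro n; rewrite !sum_n_Reals; apply sum_Rle; auto.
Qed.

Lemma ev_0 a : ev a 0 = a O.
Proof.
  apply is_CSeries_unique.
  replace (RtoC (a O)) with (a O * 0 ^ 0 + 0)%C by (simpl; ring).
  apply (is_CSeries_decr (fun n => a n * 0 ^ n)%C).
  apply is_CSeries_ext with (fun n => 0 * (psC 0 n * 0 ^ n))%C; [intro n; simpl; ring|].
  assert (E : is_CSeries (fun n => 0 * (psC 0 n * 0 ^ n))%C (0 * ev (psC 0) 0)%C)
    by (apply is_CSeries_scal, ev_is, cv_C).
  now rewrite Cmult_0_l in E.
Qed.

Lemma ev_theta a z x : cv a x -> Cmod z < x -> ev (theta a) z = (z * ev (dps a) z)%C.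
Proof.
  intros Ha Hz; destruct (Req_dec (Cmod z) 0) as [E|E].
  - apply Cmod_eq_0 in E; subst z; rewrite ev_0; unfold theta; simpl; rewrite Rmult_0_l; ring.
  - assert (Hz0 := Cmod_ge_0 z).
    assert (Hd : cv (theta a) (Cmod z)) by (apply (cv_theta a _ x); auto).
    rewrite ev_shift; [fold (dps a); unfold theta; simpl INR; rewrite Rmult_0_l; ring|lra|auto].
Qed.

Lemma ev_R a x : ev a (RtoC x) = RtoC (PSeries a x).
Proof.
  assert (E : forall n, (a n * RtoC x ^ n)%C = RtoC (a n * x ^ n)).
  { intro n; now rewrite RtoC_mult, RtoC_pow. }
  apply injective_projections.
  - change (Series (fun n => Re (a n * RtoC x ^ n)%C) = PSeries a x).
    apply Series_ext; intro n; now rewrite E.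
  - change (Series (fun n => Im (a n * RtoC x ^ n)%C) = 0).
    rewrite <- (Rmult_0_l (Series (fun _ => 0))), <- Series_scal_l; apply Series_ext.
    intro n; rewrite E; simpl; ring.
Qed.

Lemma cv_RtoC a x : 0 <= x -> cv a x -> cv a (Cmod (RtoC x)).
Proof. intros Hx H; now rewrite Cmod_R, Rabs_pos_eq. Qed.

Lemma PSeries_psM a b x : 0 <= x -> cv a x -> cv b x ->
  PSeries (a * b)%ps x = PSeries a x * PSeries b x.
Proof.
  intros Hx Ha Hb; apply RtoC_inj; rewrite RtoC_mult, <- !ev_R.
  apply ev_M; now apply cv_RtoC.
Qed.

Lemma PSeries_psD a b x : 0 <= x -> cv a x -> cv b x ->
  PSeries (a + b)%ps x = PSeries a x + PSeries b x.
Proof.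
  intros Hx Ha Hb; apply RtoC_inj; rewrite RtoC_plus, <- !ev_R.
  apply ev_D; now apply cv_RtoC.
Qed.

Lemma PSeries_psB a b x : 0 <= x -> cv a x -> cv b x ->
  PSeries (a - b)%ps x = PSeries a x - PSeries b x.
Proof.
  intros Hx Ha Hb; apply RtoC_inj; rewrite RtoC_minus, <- !ev_R.
  apply ev_B; now apply cv_RtoC.
Qed.

Lemma PSeries_psZ t a x : 0 <= x -> cv a x -> PSeries (psZ t a) x = t * PSeries a x.
Proof.
  intros Hx Ha; apply RtoC_inj; rewrite RtoC_mult, <- !ev_R.
  apply ev_Z; now apply cv_RtoC.
Qed.

Lemma PSeries_psC t x : PSeries (psC t) x = t.
Proof. apply RtoC_inj; rewrite <- ev_R; apply ev_C. Qed.

Lemma PSeries_theta a x y : 0 <= x < y -> cv a y -> PSeries (theta a) x = x * PSeries (dps a) x.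
Proof.
  intros Hx Ha; apply RtoC_inj; rewrite RtoC_mult, <- !ev_R.
  apply (ev_theta a _ y); auto; rewrite Cmod_R, Rabs_pos_eq; lra.
Qed.

Lemma entire_derive a x : entire a -> is_derive (PSeries a) x (PSeries (dps a) x).
Proof.
  intro H; apply is_derive_PSeries.
  destruct (CV_radius_bounded a) as (B & _).
  apply Rbar_lt_le_trans with (Finite (Rabs x + 1)); [simpl; lra|].
  apply B; pose proof (Rabs_pos x).
  destruct (H (Rabs x + 1) ltac:(lra)) as (M & HM); exists M; intro n.
  eapply Rle_trans; [|apply (HM n)].
  rewrite Rabs_mult, (Rabs_pos_eq ((Rabs x + 1) ^ n)) by (apply pow_le; lra).
  assert (T : forall f k, (forall j, 0 <= f j) -> f k <= sum_f_R0 f k).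
  { intros f [|k] Hf; simpl; [lra|].
    pose proof (cond_pos_sum f k Hf); lra. }
  apply (T (fun n => Rabs (a n) * (Rabs x + 1) ^ n)).
  intro j; apply Rmult_le_pos; [apply Rabs_pos|apply pow_le; lra].
Qed.

(** All terms being nonnegative, $u\le s\,k$ and [Mser s u] $\le k$ coefficientwise. *)
Lemma Kser_cv s u x : 0 < s -> 0 <= x -> nonneg u -> cv (Kser s u) x ->
  cv u x /\ cv (Mser s u) x.
Proof.
  intros Hs Hx Hu H; pose proof (nonneg_Mser s u Hs Hu) as Hm.
  assert (His : 0 < / s) by (now apply Rinv_0_lt_compat).
  assert (Hk : nonneg (Kser s u)) by (apply nonneg_D; auto; apply nonneg_Z; auto; lra).
  split.
  - apply (cv_le u (psZ s (Kser s u)) x x); auto using Rle_refl, cv_Z.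
    intro n; rewrite !nonneg_abs; auto; [|apply nonneg_Z; auto; lra].
    unfold Kser, psZ, psD.
    replace (s * (/ s * u n + Mser s u n)) with (u n + s * Mser s u n) by (field; lra).
    pose proof (Rmult_le_pos s (Mser s u n)); specialize (Hm n); lra.
  - apply (cv_le _ (Kser s u) x x); auto using Rle_refl.
    intro n; rewrite !nonneg_abs; auto.
    unfold Kser, psZ, psD; pose proof (Rmult_le_pos (/ s) (u n)); specialize (Hu n); lra.
Qed.

Definition Vser (s : R) (u : ps) : ps := (ps1 - psZ (/ s) u)%ps.

Lemma cv_Vser s u x : 0 <= x -> cv u x -> cv (Vser s u) x.
Proof. intros Hx H; apply cv_B; auto using cv_Z; apply cv_C. Qed.

Lemma cv_mono a x y : 0 <= x <= y -> cv a y -> cv a x.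
Proof. intros H; apply cv_le; auto using Rle_refl; lra. Qed.

(** A convergent formal inverse certifies nonvanishing, the three values having product 1. *)
Lemma ev_nonzero a b A z : (a * b * A)%ps = ps1 ->
  cv a (Cmod z) -> cv b (Cmod z) -> cv A (Cmod z) -> ev a z <> 0 /\ ev b z <> 0.
Proof.
  intros E Ha Hb HA.
  assert (H : (ev a z * ev b z * ev A z)%C = 1).
  { rewrite <- !ev_M; auto using cv_M, Cmod_ge_0; rewrite E; apply ev_C. }
  split; intro H0; rewrite H0 in H; apply C1_nz; rewrite <- H; ring.
Qed.

(* Here [k] plays the role of [- z F'' / F']; the bound on the disk is
   [Re k(z) <= k(|z|) < k(r)], by nonnegativity of the coefficients. *)
Lemma convexity_radius_of_series alpha F k r R' :
  0 < r < R' -> nonneg k -> k O = 0 -> (exists m, 0 < k m) -> cv k R' ->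
  Series (fun n => k n * r ^ n) = 1 - alpha ->
  (forall z, Cmod z < R' ->
     ex_derive (K := C_AbsRing) (V := C_NormedModule) F z /\
     ex_derive (K := C_AbsRing) (V := C_NormedModule) (C_derive F) z /\
     C_derive F z <> 0%C /\
     (1 + z * C_derive (C_derive F) z / C_derive F z)%C = (1 - ev k z)%C) ->
  convexity_radius alpha F = Finite r /\
  is_smallest_positive_root (convexity_equation alpha F) r.
Proof.
  intros Hr Hk Hk0 Hkm Hc HS HF.
  assert (Hre : forall x, 0 <= x < R' ->
    (1 + x * C_derive (C_derive F) x / C_derive F x)%C = RtoC (1 - Series (fun n => k n * x ^ n))).
  { intros x Hx; destruct (HF (RtoC x)) as (_ & _ & _ & E).
    - rewrite Cmod_R, Rabs_pos_eq; lra.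
    - rewrite E, ev_R, RtoC_minus; reflexivity. }
  assert (Hlt : forall x, 0 <= x < r -> Series (fun n => k n * x ^ n) < 1 - alpha).
  { intros x Hx; rewrite <- HS; apply Series_strict; auto.
    apply (cv_mono k r R'); auto; lra. }
  split.
  - apply is_lub_Rbar_unique; split.
    (* On a larger disk the point $z=r$ itself violates the strict inequality. *)
    + intros x (Hx & Hx'); apply Rnot_lt_le; intro Hrx.
      destruct (Hx' (RtoC r)) as (_ & _ & _ & Hgt).
      * rewrite Cmod_R, Rabs_pos_eq; lra.
      * rewrite Hre, HS, re_RtoC in Hgt by lra; lra.
    (* The disk is open, so the radius [r] itself is admissible. *)
    + intros b Hb; apply Hb; split; [lra|]; intros z Hz.
      destruct (HF z ltac:(lra)) as (H1 & H2 & H3 & H4); repeat split; auto.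
      rewrite H4.
      assert (Hz0 := Cmod_ge_0 z).
      assert (Hcz : cv k (Cmod z)) by (apply (cv_mono k _ R'); auto; lra).
      assert (B : Re (ev k z) <= Series (fun n => k n * Cmod z ^ n)).
      { apply is_series_le with (2 := proj1 (ev_is k z Hcz))
          (3 := is_series_cv k _ Hcz Hz0 Hk).
        intro n; rewrite re_scal_l; apply Rmult_le_compat_l; [apply Hk|].
        rewrite <- Cmod_pow; eapply Rle_trans; [apply Rle_abs|apply Re_Im_le]. }
      specialize (Hlt (Cmod z) ltac:(lra)).
      replace (Re (1 - ev k z)%C) with (1 - Re (ev k z)) by reflexivity; lra.
  - split; [lra|]; split.
    + split; [apply HF; rewrite Cmod_R, Rabs_pos_eq; lra|].
      rewrite Hre, HS by lra; f_equal; ring.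
    + intros x Hx (_ & E); apply Rnot_lt_le; intro Hxr.
      rewrite Hre in E by lra; apply RtoC_inj in E.
      specialize (Hlt x ltac:(lra)); lra.
Qed.

Lemma RtoC_m1 : RtoC (-1) = (- (1))%C.
Proof. unfold Copp; simpl; now rewrite Ropp_0. Qed.

Lemma C_derive_funext F G : (forall z, is_Cderive F z (G z)) -> C_derive F = G.
Proof.
  intro H; apply functional_extensionality; intro z; now apply is_C_derive_unique.
Qed.

Lemma psZ_inv1 u : psZ (/ 1) u = u.
Proof. apply functional_extensionality; intro n; unfold psZ; field. Qed.

(** For $s=1$ no logarithm occurs: $F'$ is the entire series $\psi=$ [Top 1 phi], and
    $-zF''/F'=-\theta\psi/\psi$ is [Kser 1 u] by [neg_logder_Top]. *)
Lemma convexity_z_series alpha phi u :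
  entire phi -> neg_logder phi u -> (exists n, phi (S n) <> 0) -> alpha < 1 ->
  let F := fun z => (z * ev phi z)%C in
  exists r, is_smallest_positive_root (convexity_equation alpha F) r /\
    convexity_radius alpha F = Finite r.
Proof.
  intros He H Hn Ha F.
  assert (Hu : nonneg u) by apply H.
  destruct (convexity_root phi u 1 (1 - alpha) He H Hn Rlt_0_1 ltac:(lra))
    as (r & R' & Hr & HK & HS & A & HA & HcA).
  exists r; apply and_comm.
  apply (convexity_radius_of_series alpha F (Kser 1 u) r R'); auto.
  - apply nonneg_Kser; auto; lra.
  - now apply Kser_0, neg_logder_u0 with phi.
  - apply Kser_pos_coef with phi; auto; lra.
  - intros z Hz.
    set (psi := Top 1 phi).
    assert (Hepsi : entire psi) by (now apply entire_Top).
    assert (HF1 : forall w, is_Cderive F w (ev psi w)).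
    { intro w; replace (ev psi w) with (1 * ev phi w + w * ev (dps phi) w)%C.
      - apply (is_Cderive_mult (fun v => v) (ev phi)); [apply is_Cderive_id|].
        apply (ev_derive phi w (Cmod w + 1)); [|lra].
        apply He; pose proof (Cmod_ge_0 w); lra.
      - unfold psi, Top; rewrite psZ_inv1, ev_D
          by (first [apply He|apply (entire_theta _ He)]; apply Cmod_ge_0).
        rewrite (ev_theta phi w (Cmod w + 1)); [ring| |lra].
        apply He; pose proof (Cmod_ge_0 w); lra. }
    assert (HF2 : forall w, is_Cderive (ev psi) w (ev (dps psi) w)).
    { intro w; apply (ev_derive psi w (Cmod w + 1)); [|lra].
      apply Hepsi; pose proof (Cmod_ge_0 w); lra. }
    rewrite (C_derive_funext F (ev psi) HF1), (C_derive_funext (ev psi) (ev (dps psi)) HF2).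
    assert (Hz0 := Cmod_ge_0 z).
    destruct (Kser_cv 1 u R' Rlt_0_1 ltac:(lra) Hu HK) as (Hcu & Hcm).
    assert (Hcz : forall a, cv a R' -> cv a (Cmod z)) by (intro; apply cv_mono; lra).
    assert (HcV : cv (Vser 1 u) (Cmod z)) by (apply cv_Vser; auto).
    destruct (ev_nonzero phi (Vser 1 u) A z HA (He _ Hz0) HcV (Hcz _ HcA)) as (N1 & N2).
    assert (Hnz : ev psi z <> 0).
    { unfold psi; rewrite (Top_fact 1 phi u H).
      change (ev (phi * Vser 1 u)%ps z <> 0); rewrite ev_M by auto.
      now apply Cmult_neq_0. }
    repeat split; auto; [eexists; apply HF1|eexists; apply HF2|].
    rewrite <- (ev_theta psi z R') by (auto; apply Hepsi; lra).
    destruct (neg_logder_Top 1 phi u Rlt_0_1 H) as (_ & _ & E); fold psi in E.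
    assert (E' : theta psi = (psC (-1) * (Kser 1 u * psi))%ps).
    { rewrite E; unfold Kser; rewrite psZ_inv1, psM_C.
      apply functional_extensionality; intro n; unfold psN, psZ; ring. }
    rewrite E', !ev_M, ev_C by (auto using cv_M, cv_C).
    rewrite RtoC_m1.
    field; assumption.
Qed.

(** * The logarithm branch and powers of a series *)

Lemma norm_C_R (x : C) : norm (K := R_AbsRing) (V := C_R_NormedModule) x = Cmod x.
Proof.
  change (sqrt (Rabs (fst x) ^ 2 + Rabs (snd x) ^ 2) = sqrt (fst x ^ 2 + snd x ^ 2)).
  now rewrite !pow2_abs.
Qed.

(** Connects complex derivatives with the integral over a real parameter in [Clog_branch]. *)
Lemma is_derive_ray (F : C -> C) (z : C) (t : R) l : is_Cderive F (t * z)%C l ->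
  is_derive (K := R_AbsRing) (V := C_R_NormedModule) (fun s => F (RtoC s * z)%C) t (z * l)%C.
Proof.
  intros (_ & H); split; [apply is_linear_scal_l|].
  intros x Hx; apply (@is_filter_lim_locally_unique R_AbsRing R_NormedModule) in Hx; subst x.
  intro eps; pose proof (cond_pos eps) as He.
  assert (Hz := Cmod_ge_0 z).
  assert (He' : 0 < eps / (Cmod z + 1)) by (apply Rdiv_lt_0_compat; lra).
  destruct (H (t * z)%C (fun P HP => HP) (mkposreal _ He')) as (d & Hd).
  assert (Hd' : 0 < d / (Cmod z + 1)) by (apply Rdiv_lt_0_compat; [apply cond_pos|lra]).
  exists (mkposreal _ Hd'); intros s Hs.
  change (Rabs (s - t) < d / (Cmod z + 1)) in Hs.
  assert (E : (s * z - t * z)%C = ((s - t)%R * z)%C) by (rewrite RtoC_minus; ring).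
  assert (B : Rabs (s - t) * (Cmod z + 1) < d).
  { replace (pos d) with (d / (Cmod z + 1) * (Cmod z + 1)) by (field; lra).
    apply Rmult_lt_compat_r; lra. }
  pose proof (Rabs_pos (s - t)) as Hst.
  specialize (Hd (s * z)%C).
  change (Cmod (s * z - t * z)%C < d ->
    Cmod (F (s * z) - F (t * z) - (s * z - t * z) * l)%C
    <= eps / (Cmod z + 1) * Cmod (s * z - t * z)%C) in Hd.
  rewrite E, Cmod_mult, Cmod_R in Hd; specialize (Hd ltac:(nra)).
  rewrite norm_C_R.
  change (Cmod (F (s * z) - F (t * z) - scal (V := C_R_NormedModule) (s - t)%R (z * l))%C
    <= eps * Rabs (s - t)).
  rewrite scal_R_Cmult, Cmult_assoc.
  eapply Rle_trans; [exact Hd|].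
  apply Rle_trans with (eps / (Cmod z + 1) * (Rabs (s - t) * (Cmod z + 1))).
  - apply Rmult_le_compat_l; nra.
  - right; field; lra.
Qed.

(* Antiderivative of [- u / x]. *)
Definition logser (u : ps) : ps :=
  fun n => match n with O => 0 | S _ => - u n / INR n end.

Lemma logser_theta u : u O = 0 -> theta (logser u) = psZ (-1) u.
Proof.
  intro H; apply functional_extensionality; intros [|n]; unfold theta, logser, psZ.
  - rewrite H; ring.
  - field; apply not_0_INR; lia.
Qed.

Lemma cv_logser u x : 0 <= x -> cv u x -> cv (logser u) x.
Proof.
  intros Hx H; apply (cv_le _ u x x); auto using Rle_refl; intros [|n]; unfold logser.
  - rewrite Rabs_R0; apply Rabs_pos.
  - assert (1 <= INR (S n)) by (rewrite S_INR; pose proof (pos_INR n); lra).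
    unfold Rdiv; rewrite Rabs_mult, Rabs_Ropp, (Rabs_pos_eq (/ _)).
    + rewrite <- (Rmult_1_r (Rabs (u (S n)))) at 2.
      apply Rmult_le_compat_l; [apply Rabs_pos|].
      rewrite <- Rinv_1; apply Rinv_le_contravar; lra.
    + left; apply Rinv_0_lt_compat; lra.
Qed.

Lemma dps_neg_logder phi u : neg_logder phi u -> dps phi = (psZ (-1) (shift u) * phi)%ps.
Proof.
  intro H; pose proof (neg_logder_u0 _ _ H) as H0; destruct H as (_ & _ & H).
  unfold dps; rewrite H; apply functional_extensionality; intro n.
  rewrite psM_Zl; unfold shift at 1, psN; simpl; rewrite H0; ring.
Qed.

(** Since $\phi'/\phi=-u/x$, the integrand is the derivative of $t\mapsto$ [ev (logser u)] at $tz$;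
    cancelling $\phi$ is where its freedom from zeros enters. *)
Lemma Clog_branch_series phi u z x : entire phi -> neg_logder phi u -> cv u x ->
  Cmod z < x -> (forall w, Cmod w < x -> ev phi w <> 0) ->
  Clog_branch (ev phi) z = ev (logser u) z.
Proof.
  intros He H Hu Hz Hnz; unfold Clog_branch.
  assert (Hz0 := Cmod_ge_0 z).
  set (y := (Cmod z + x) / 2).
  assert (Hl : cv (logser u) x) by (apply cv_logser; auto; lra).
  assert (Hdl : cv (dps (logser u)) y) by (apply (cv_dps _ x); auto; unfold y; lra).
  assert (Hu0 := neg_logder_u0 _ _ H).
  assert (Hds : dps (logser u) = psZ (-1) (shift u))
    by (unfold dps; now rewrite logser_theta).
  assert (HD : C_derive (ev phi) = ev (dps phi)).
  { apply C_derive_funext; intro w; apply (ev_derive phi w (Cmod w + 1)); [|lra].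
    apply He; pose proof (Cmod_ge_0 w); lra. }
  assert (Ht : forall t, 0 <= t <= 1 -> Cmod (t * z)%C <= Cmod z).
  { intros t Ht; rewrite Cmod_mult, Cmod_R, Rabs_pos_eq by lra; nra. }
  assert (E : is_RInt (V := C_R_NormedModule) (fun t => z * ev (dps (logser u)) (RtoC t * z))%C 0 1
                (minus (ev (logser u) (1 * z)%C) (ev (logser u) (0 * z)%C))).
  { apply (@is_RInt_derive C_R_CompleteNormedModule
             (fun t => ev (logser u) (RtoC t * z)%C)).
    - intros t Ht'; rewrite Rmin_left, Rmax_right in Ht' by lra.
      apply is_derive_ray, (ev_derive _ _ x); auto.
      eapply Rle_lt_trans; [apply Ht|]; auto.
    - intros t Ht'; rewrite Rmin_left, Rmax_right in Ht' by lra.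
      apply (@ex_derive_continuous R_AbsRing C_R_NormedModule).
      eexists; apply (is_derive_ray (fun w => z * ev (dps (logser u)) w)%C).
      apply (is_Cderive_mult (fun _ => z) (ev (dps (logser u)))); [apply is_Cderive_const|].
      apply (ev_derive _ _ y); auto.
      eapply Rle_lt_trans; [apply Ht; auto|unfold y; lra]. }
  rewrite (RInt_ext (V := C_R_CompleteNormedModule) _
             (fun t => z * ev (dps (logser u)) (RtoC t * z))%C).
  - rewrite (is_RInt_unique (V := C_R_CompleteNormedModule) _ _ _ _ E).
    change (ev (logser u) (1 * z) - ev (logser u) (0 * z) = ev (logser u) z)%C.
    rewrite Cmult_1_l, Cmult_0_l, ev_0; unfold logser at 2; ring.
  - intros t Ht'; rewrite Rmin_left, Rmax_right in Ht' by lra.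
    assert (Htz := Ht t ltac:(lra)).
    rewrite HD, (dps_neg_logder phi u H), <- Hds, ev_M.
    + match goal with |- ?a = ?b => change (@eq C a b) end.
      field; apply Hnz; lra.
    + apply (cv_mono _ _ y); auto; split; [apply Cmod_ge_0|unfold y; lra].
    + apply He, Cmod_ge_0.
Qed.

Lemma Mser_ev s u z x : 0 < s -> nonneg u -> u O = 0 -> cv (Kser s u) x -> Cmod z < x ->
  (ev (Mser s u) z * ev (Vser s u) z)%C = (RtoC (/ s) * ev (theta u) z)%C.
Proof.
  intros Hs Hu Hu0 HK Hz; assert (Hz0 := Cmod_ge_0 z).
  destruct (Kser_cv s u x Hs ltac:(lra) Hu HK) as (Hcu & Hcm).
  assert (Hcuz : cv u (Cmod z)) by (apply cv_mono with x; auto; lra).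
  rewrite <- ev_M; [|apply cv_mono with x; auto; lra|now apply cv_Vser].
  unfold Vser; rewrite Mser_eq by assumption; apply ev_Z.
  now apply (cv_theta u _ x).
Qed.

(** On the disk of radius $R'$ one has $F=zE$ and $F'=E\,(1-u/s)$, where $E=\phi^{1/s}$ is the
    exponential of a power series. The formulas hold on this disk only, so [C_derive F] is
    differentiated through local equality. *)
Lemma convexity_power alpha phi u s r R' A :
  entire phi -> neg_logder phi u -> (exists n, phi (S n) <> 0) -> 0 < s ->
  0 < r < R' -> cv (Kser s u) R' -> (phi * (ps1 - psZ (/ s) u) * A)%ps = ps1 -> cv A R' ->
  Series (fun n => Kser s u n * r ^ n) = 1 - alpha ->
  convexity_radius alpha
    (fun z => z * Cexp (Clog_branch (ev phi) z * RtoC (/ s)))%C = Finite r.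
Proof.
  intros He H Hn Hs Hr HK HA HcA HS.
  set (F := fun z => (z * Cexp (Clog_branch (ev phi) z * RtoC (/ s)))%C).
  assert (Hu : nonneg u) by apply H.
  assert (Hu0 := neg_logder_u0 _ _ H).
  destruct (Kser_cv s u R' Hs ltac:(lra) Hu HK) as (Hcu & Hcm).
  assert (HV : cv (Vser s u) R') by (apply cv_Vser; auto; lra).
  assert (HR : forall w a, Cmod w < R' -> cv a R' -> cv a (Cmod w)).
  { intros w a Hw Ha; apply cv_mono with R'; auto; split; [apply Cmod_ge_0|lra]. }
  assert (Hnz : forall w, Cmod w < R' -> ev phi w <> 0 /\ ev (Vser s u) w <> 0).
  { intros w Hw; apply (ev_nonzero phi (Vser s u) A w HA); auto.
    apply He, Cmod_ge_0. }
  set (L := logser u).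
  assert (HL : cv L R') by (apply cv_logser; auto; lra).
  assert (HdL : forall w, Cmod w < R' -> (w * ev (dps L) w)%C = (- ev u w)%C).
  { intros w Hw; rewrite <- (ev_theta L w R') by auto.
    unfold L; rewrite logser_theta, ev_Z by auto.
    rewrite RtoC_m1.
    ring. }
  set (E := fun w => Cexp (ev L w * RtoC (/ s))%C).
  assert (HVe : forall w, Cmod w < R' -> ev (Vser s u) w = (1 - RtoC (/ s) * ev u w)%C).
  { intros w Hw; unfold Vser; rewrite ev_B, ev_Z by (auto using cv_Z; apply cv_C).
    unfold ps1; now rewrite ev_C. }
  assert (HE : forall w, Cmod w < R' -> is_Cderive E w (ev (dps L) w * RtoC (/ s) * E w)%C).
  { intros w Hw; apply (is_Cderive_comp Cexp (fun v => ev L v * RtoC (/ s))%C).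
    - apply Cexp_derive.
    - replace (ev (dps L) w * RtoC (/ s))%C
        with (ev (dps L) w * RtoC (/ s) + ev L w * 0)%C by ring.
      apply (is_Cderive_mult (ev L) (fun _ => RtoC (/ s))).
      + now apply ev_derive with R'.
      + apply is_Cderive_const. }
  assert (HF : forall w, Cmod w < R' -> is_Cderive F w (E w * ev (Vser s u) w)%C).
  { intros w Hw; apply (is_Cderive_ext_disk (fun v => v * E v)%C F w _ R' Hw).
    - intros v Hv; unfold F, E; rewrite (Clog_branch_series phi u v R'); auto.
      intros x Hx; exact (proj1 (Hnz x Hx)).
    - replace (E w * ev (Vser s u) w)%C
        with (1 * E w + w * (ev (dps L) w * RtoC (/ s) * E w))%C.
      + apply (is_Cderive_mult (fun v => v) E); [apply is_Cderive_id|auto].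
      + rewrite HVe by assumption.
        transitivity (E w + (w * ev (dps L) w) * (RtoC (/ s) * E w))%C; [ring|].
        rewrite HdL by assumption; ring. }
  assert (HF' : forall w, Cmod w < R' -> is_Cderive (C_derive F) w
     (ev (dps L) w * RtoC (/ s) * E w * ev (Vser s u) w + E w * ev (dps (Vser s u)) w)%C).
  { intros w Hw.
    apply (is_Cderive_ext_disk (fun v => E v * ev (Vser s u) v)%C (C_derive F) w _ R' Hw).
    - intros v Hv; symmetry; apply is_C_derive_unique; auto.
    - apply (is_Cderive_mult E (ev (Vser s u))); auto.
      now apply ev_derive with R'. }
  apply (convexity_radius_of_series alpha F (Kser s u) r R'); auto.
  - now apply nonneg_Kser.
  - now apply Kser_0.
  - now apply Kser_pos_coef with phi.
  - intros z Hz; destruct (Hnz z Hz) as (_ & HVz).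
    assert (HEz : E z <> 0) by apply Cexp_neq_0.
    rewrite (is_C_derive_unique _ _ _ (HF' z Hz)), (is_C_derive_unique _ _ _ (HF z Hz)).
    split; [eexists; now apply HF|]; split; [eexists; now apply HF'|].
    split; [now apply Cmult_neq_0|].
    (* The logarithmic derivative of $1-u/s$, which becomes the second summand of [Kser]. *)
    assert (Hu' : (z * ev (dps (Vser s u)) z)%C = (- (ev (Mser s u) z * ev (Vser s u) z))%C).
    { rewrite (Mser_ev s u z R') by auto.
      rewrite <- (ev_theta (Vser s u) z R') by auto; unfold Vser.
      rewrite theta_B, theta_1, theta_Z.
      replace (ps0 - psZ (/ s) (theta u))%ps with (psZ (- / s) (theta u)).
      - rewrite ev_Z, RtoC_opp; [ring|].
        apply (cv_theta u _ R'); auto using Cmod_ge_0.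
      - apply functional_extensionality; intro n; unfold psB, psZ, ps0; ring. }
    unfold Kser; rewrite ev_D, ev_Z by auto using cv_Z.
    transitivity (1 + ((z * ev (dps L) z) * RtoC (/ s) * ev (Vser s u) z
                       + z * ev (dps (Vser s u)) z) / ev (Vser s u) z)%C.
    { field; auto. }
    rewrite HdL, Hu' by assumption; field; assumption.
Qed.

(** * Struve functions *)

(** All factors of $(k)_n$ after the first are at least 1. The bound dominates the Struve series by
    $e^{cx}/\min(k,1)$. *)
Lemma rf_lower k n : 0 < k -> Rmin k 1 <= rf k n.
Proof.
  intro Hk; destruct n as [|n]; [apply Rmin_r|].
  induction n as [|n IH].
  - simpl; rewrite Rmult_1_l, Rplus_0_r; apply Rmin_l.
  - change (rf k (S (S n))) with (rf k (S n) * (k + INR (S n))).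
    pose proof (rf_pos k (S n) Hk); rewrite S_INR; pose proof (pos_INR n).
    eapply Rle_trans; [exact IH|].
    rewrite <- (Rmult_1_r (rf k (S n))) at 1; apply Rmult_le_compat_l; lra.
Qed.

Definition struve_series (c k : R) (q : nat) : ps :=
  fun n => (- c) ^ n / INR (fact n) / rf k (q * n).

Lemma struve_series_entire c k q : 0 <= c -> 0 < k -> entire (struve_series c k q).
Proof.
  intros Hc Hk x Hx; set (mu := Rmin k 1).
  assert (Hmu : 0 < mu) by (apply Rmin_glb_lt; lra).
  exists (/ mu * exp (c * x)); intro N.
  eapply Rle_trans; [|apply Rmult_le_compat_l;
    [left; now apply Rinv_0_lt_compat|apply (exp_ge_taylor (c * x) N); now apply Rmult_le_pos]].
  unfold nrm; rewrite scal_sum; apply sum_Rle; intros n _; unfold struve_series.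
  pose proof (INR_fact_lt_0 n) as Hf; pose proof (rf_pos k (q * n) Hk) as Hr.
  pose proof (rf_lower k (q * n) Hk) as Hl; fold mu in Hl.
  unfold Rdiv; rewrite !Rabs_mult, <- RPow_abs, Rabs_Ropp, (Rabs_pos_eq c) by assumption.
  rewrite !Rabs_pos_eq by (left; now apply Rinv_0_lt_compat).
  rewrite Rpow_mult_distr.
  apply Rle_trans with (c ^ n * / INR (fact n) * / mu * x ^ n); [|right; ring].
  apply Rmult_le_compat_r; [now apply pow_le|].
  apply Rmult_le_compat_l; [|now apply Rinv_le_contravar].
  apply Rmult_le_pos; [now apply pow_le|left; now apply Rinv_0_lt_compat].
Qed.

Lemma struve_series_logder c k q : 0 <= c -> 0 < k -> (0 < q)%nat ->
  has_logder (struve_series c k q).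
Proof.
  intros Hc Hk Hq; apply has_logder_div_rf_mult; auto; now apply has_logder_exp.
Qed.

Lemma entire_sc t a : 0 <= t -> entire a -> entire (sc t a).
Proof.
  intros Ht H x Hx; destruct (H (t * x)) as (M & HM); [now apply Rmult_le_pos|].
  exists M; intro N; eapply Rle_trans; [|apply (HM N)]; right.
  apply sum_eq; intros n _; unfold sc.
  rewrite Rabs_mult, (Rabs_pos_eq (t ^ n)), Rpow_mult_distr by (now apply pow_le); ring.
Qed.

Lemma entire_sq_subst a : entire a -> entire (sq_subst a).
Proof.
  intros H x Hx; destruct (H (x * x)) as (M & HM); [nra|].
  exists M; intro N; eapply Rle_trans; [|apply (HM N)]; clear H M HM.
  assert (Hxx : 0 <= x * x) by nra.
  revert a; induction N as [| |N IH] using nat_ind2; intro a.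
  - unfold nrm; simpl; lra.
  - unfold nrm; simpl; rewrite Rabs_R0.
    pose proof (Rmult_le_pos _ _ (Rabs_pos (a 1%nat)) Hxx); lra.
  - rewrite !nrm_S.
    change (shift (sq_subst a) O) with 0; rewrite Rabs_R0, Rplus_0_l.
    change (shift (shift (sq_subst a))) with (sq_subst (shift a)).
    change (sq_subst a O) with (a O).
    specialize (IH (shift a)).
    rewrite <- (nrm_S (shift a)).
    pose proof (nrm_incr (shift a) (x * x) N (S N) Hxx ltac:(lia)).
    apply Rplus_le_compat_l; rewrite <- Rmult_assoc; apply Rmult_le_compat_l; lra.
Qed.

(** Read as a power series at 1, where [is_pseries_odd_even] separates the parities. *)
Lemma is_series_even (b : nat -> R) l : (forall n, b (2 * n + 1)%nat = 0) ->
  is_series (fun n => b (2 * n)%nat) l -> is_series b l.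
Proof.
  intros Hb H.
  assert (E : forall (f : nat -> R) m, is_series f m <-> is_pseries f 1 m).
  { intros f m; rewrite is_pseries_R; split; apply is_series_ext; intro n; rewrite pow1;
      [symmetry|]; exact (Rmult_1_r (f n)). }
  apply (proj2 (E _ _)); replace l with (l + 1 * 0) by ring.
  apply is_pseries_odd_even; rewrite pow1; apply (proj1 (E _ _)); [exact H|].
  apply is_series_ext with (fun _ => 0); [intro; now rewrite Hb|exact is_series_zero].
Qed.

Lemma ev_sq_subst a z : cv a (Cmod (z * z)) -> ev (sq_subst a) z = ev a (z * z)%C.
Proof.
  intro H; apply is_CSeries_unique; destruct (ev_is a _ H) as (H1 & H2).
  assert (Eo : forall n, (sq_subst a (2 * n + 1) * z ^ (2 * n + 1))%C = 0)
    by (intro n; rewrite sq_subst_odd; ring).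
  assert (Ee : forall n, (sq_subst a (2 * n) * z ^ (2 * n))%C = (a n * (z * z) ^ n)%C).
  { intro n; rewrite sq_subst_even, Cpow_mult_r; do 2 f_equal; simpl; ring. }
  split; apply is_series_even; try (intro n; now rewrite Eo).
  - apply is_series_ext with (2 := H1); intro n; now rewrite Ee.
  - apply is_series_ext with (2 := H2); intro n; now rewrite Ee.
Qed.

Lemma ev_sc t a z : ev (sc t a) z = ev a (t * z)%C.
Proof.
  unfold ev; f_equal; apply functional_extensionality; intro n; unfold sc.
  rewrite Cpow_mult_l, RtoC_mult, RtoC_pow; ring.
Qed.

Lemma struve_coeff_series q p b c delta n : 0 < struve_kappa p b delta ->
  struve_coeff q p b c delta n
  = / Gamma (struve_kappa p b delta) * struve_series c (struve_kappa p b delta) q n.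
Proof.
  intro Hk; unfold struve_coeff, struve_series; set (k := struve_kappa p b delta) in *.
  rewrite <- mult_INR, Gamma_rf by assumption.
  pose proof (Gamma_pos k Hk); pose proof (rf_pos k (q * n) Hk); pose proof (INR_fact_lt_0 n).
  rewrite <- Rpow_mult_distr; replace (-1 * c) with (- c) by ring.
  field; lra.
Qed.

Lemma struve_Cseries q p b c delta w : 0 <= c -> 0 < struve_kappa p b delta ->
  (Gamma (struve_kappa p b delta) * CSeries (fun n => struve_coeff q p b c delta n * w ^ n))%C
  = ev (struve_series c (struve_kappa p b delta) q) w.
Proof.
  intros Hc Hk; pose proof (Gamma_pos _ Hk) as HG.
  pose proof (ev_is _ w (struve_series_entire c _ q Hc Hk _ (Cmod_ge_0 w))) as H.
  apply (is_CSeries_scal (/ Gamma (struve_kappa p b delta))%R) in H.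
  rewrite (is_CSeries_unique _ (/ Gamma (struve_kappa p b delta)
              * ev (struve_series c (struve_kappa p b delta) q) w)%C).
  - field; intro E; apply RtoC_inj in E; lra.
  - rewrite <- RtoC_inv by lra.
    apply is_CSeries_ext with (2 := H); intro n.
    rewrite struve_coeff_series, RtoC_mult by assumption; ring.
Qed.

(** The Struve series at $x^2/4$, shared by f and g; [phi_h] is the same series at $x/4$. *)
Definition phi_g (c k : R) (q : nat) : ps := sq_subst (sc (/ 4) (struve_series c k q)).
Definition phi_h (c k : R) (q : nat) : ps := sc (/ 4) (struve_series c k q).

Lemma phi_g_entire c k q : 0 <= c -> 0 < k -> entire (phi_g c k q).
Proof.
  intros Hc Hk; apply entire_sq_subst, entire_sc; [lra|now apply struve_series_entire].
Qed.

Lemma RtoC_4_inv : RtoC (/ 4) = (/ 4)%C.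
Proof. apply RtoC_inv; lra. Qed.

Lemma C4_nz : (4 : C) <> 0.
Proof. intro E; apply RtoC_inj in E; lra. Qed.

Lemma C2_nz : (2 : C) <> 0.
Proof. intro E; apply RtoC_inj in E; lra. Qed.

Lemma C4_22 : RtoC 4 = (2 * 2)%C.
Proof. rewrite <- RtoC_mult; f_equal; ring. Qed.

Lemma struve_phi_ev q p b c delta : 0 <= c -> 0 < struve_kappa p b delta ->
  struve_phi q p b c delta = ev (phi_g c (struve_kappa p b delta) q).
Proof.
  intros Hc Hk; apply functional_extensionality; intro z.
  unfold struve_phi, phi_g; rewrite ev_sq_subst, ev_sc.
  2:{ apply entire_sc; [lra|now apply struve_series_entire|apply Cmod_ge_0]. }
  rewrite <- (struve_Cseries q p b c delta) by assumption; do 2 f_equal.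
  apply functional_extensionality; intro n; f_equal.
  rewrite Cpow_mult_r; f_equal; simpl; rewrite RtoC_4_inv, C4_22; field; apply C2_nz.
Qed.

Lemma struve_h_ev q p b c delta : 0 <= c -> 0 < struve_kappa p b delta ->
  struve_h q p b c delta = (fun z => z * ev (phi_h c (struve_kappa p b delta) q) z)%C.
Proof.
  intros Hc Hk; apply functional_extensionality; intro z.
  unfold struve_h, phi_h; rewrite ev_sc, <- (struve_Cseries q p b c delta) by assumption.
  do 3 f_equal; apply functional_extensionality; intro n; do 2 f_equal.
  rewrite RtoC_4_inv; field; apply C4_nz.
Qed.

(** Splits off the real power $(x/2)^{p+1}$, so that the equation for f becomes one between values
    of entire series. *)
Lemma struve_W_eq q p b c delta x : 0 <= c -> 0 < struve_kappa p b delta -> 0 < x ->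
  struve_W q p b c delta x =
  / Gamma (struve_kappa p b delta) * (Rpower (x / 2) (p + 1)
    * PSeries (phi_g c (struve_kappa p b delta) q) x).
Proof.
  intros Hc Hk Hx.
  assert (E : PSeries (phi_g c (struve_kappa p b delta) q) x
            = PSeries (struve_series c (struve_kappa p b delta) q) ((x / 2) * (x / 2))).
  { apply RtoC_inj; rewrite <- !ev_R; unfold phi_g; rewrite ev_sq_subst, ev_sc.
    - f_equal; rewrite <- !RtoC_mult; f_equal; field.
    - apply entire_sc; [lra|now apply struve_series_entire|apply Cmod_ge_0]. }
  rewrite E; unfold struve_W, PSeries; rewrite <- Rmult_assoc, <- Series_scal_l.
  apply Series_ext; intro n; rewrite struve_coeff_series by assumption.
  replace ((x / 2 * (x / 2)) ^ n) with (Rpower (x / 2) (INR (2 * n)))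
    by (rewrite Rpower_pow, pow_mult by lra; f_equal; simpl; ring).
  replace (2 * INR n + p + 1) with ((p + 1) + INR (2 * n)) by (rewrite mult_INR; simpl; ring).
  rewrite Rpower_plus; ring.
Qed.

Lemma locally_pos x : 0 < x -> locally x (fun t => 0 < t).
Proof.
  intro Hx; exists (mkposreal x Hx); intros t Ht; change (Rabs (t - x) < x) in Ht.
  apply Rabs_def2 in Ht; lra.
Qed.

Lemma Rpower_half_derive s x : 0 < x ->
  is_derive (fun t => Rpower (t / 2) s) x (s / x * Rpower (x / 2) s).
Proof. intro Hx; unfold Rpower; auto_derive; [lra|]; unfold Rdiv; field; lra. Qed.

(** $(x^s\phi)'=s\,x^{s-1}(\phi+x\phi'/s)$: this is how [Top s] with $s=p+1$ enters the equation for
    f. *)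
Lemma struve_W_derive q p b c delta x : 0 <= c -> 0 < struve_kappa p b delta -> 0 < x ->
  0 < p + 1 ->
  is_derive (struve_W q p b c delta) x
    (/ Gamma (struve_kappa p b delta) * (Rpower (x / 2) (p + 1) * ((p + 1) / x)
      * PSeries (Top (p + 1) (phi_g c (struve_kappa p b delta) q)) x)).
Proof.
  intros Hc Hk Hx Hp; set (k := struve_kappa p b delta) in *; set (phi := phi_g c k q).
  assert (He : entire phi) by (now apply phi_g_entire).
  apply is_derive_ext_loc with
    (fun t => / Gamma k * (Rpower (t / 2) (p + 1) * PSeries phi t)).
  { apply filter_imp with (2 := locally_pos x Hx); intros t Ht; symmetry; now apply struve_W_eq. }
  unfold Top; rewrite PSeries_psD, PSeries_psZ, (PSeries_theta phi x (x + 1));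
    try (apply He; lra); try (apply (entire_theta _ He); lra);
    try (apply cv_Z, (entire_theta _ He); lra); try lra.
  replace (Rpower (x / 2) (p + 1) * ((p + 1) / x) *
     (PSeries phi x + / (p + 1) * (x * PSeries (dps phi) x)))
    with ((p + 1) / x * Rpower (x / 2) (p + 1) * PSeries phi x
          + Rpower (x / 2) (p + 1) * PSeries (dps phi) x) by (field; lra).
  apply is_derive_scal, (is_derive_mult (fun t => Rpower (t / 2) (p + 1)) (PSeries phi)).
  - now apply Rpower_half_derive.
  - now apply entire_derive.
  - exact Rmult_comm.
Qed.

Lemma struve_W_derive2 q p b c delta x : 0 <= c -> 0 < struve_kappa p b delta -> 0 < x ->
  0 < p + 1 ->
  let psi := Top (p + 1) (phi_g c (struve_kappa p b delta) q) in
  Derive_n (struve_W q p b c delta) 2 x =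
  / Gamma (struve_kappa p b delta) * (Rpower (x / 2) (p + 1) * ((p + 1) / x)
      * (p / x * PSeries psi x + PSeries (dps psi) x)).
Proof.
  intros Hc Hk Hx Hp psi; set (k := struve_kappa p b delta) in *.
  assert (He : entire (phi_g c k q)) by (now apply phi_g_entire).
  assert (Hpsi : entire psi) by (now apply entire_Top).
  apply is_derive_unique.
  apply is_derive_ext_loc with
    (fun t => / Gamma k * (Rpower (t / 2) (p + 1) * ((p + 1) / t) * PSeries psi t)).
  { apply filter_imp with (2 := locally_pos x Hx); intros t Ht; symmetry.
    now apply is_derive_unique, struve_W_derive. }
  replace (Rpower (x / 2) (p + 1) * ((p + 1) / x) * (p / x * PSeries psi x + PSeries (dps psi) x))
    with ((((p + 1) / x * Rpower (x / 2) (p + 1)) * ((p + 1) / x)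
            + Rpower (x / 2) (p + 1) * (- (p + 1) / (x * x))) * PSeries psi x
          + (Rpower (x / 2) (p + 1) * ((p + 1) / x)) * PSeries (dps psi) x) by (field; lra).
  apply is_derive_scal,
    (is_derive_mult (fun t => Rpower (t / 2) (p + 1) * ((p + 1) / t)) (PSeries psi)).
  - apply (is_derive_mult (fun t => Rpower (t / 2) (p + 1)) (fun t => (p + 1) / t)).
    + now apply Rpower_half_derive.
    + auto_derive; [lra|]; field; lra.
    + exact Rmult_comm.
  - now apply entire_derive.
  - exact Rmult_comm.
Qed.

(** With $s=p+1$ and $M=$ [Mser s u], one finds $xW'/W=s-u$ and $xW''/W'=s-1-u-M$, so the left side
    of the equation is $1-u/s-M=1-k(x)$. Convergence of [A] makes $W$ and $W'$ nonzero on
    $(0,R')$. *)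
Lemma struve_f_equation_series q p b c delta alpha x u R' A :
  let k := struve_kappa p b delta in
  let phi := phi_g c k q in
  0 <= c -> 0 < k -> 0 < p + 1 -> neg_logder phi u -> 0 < x < R' ->
  cv (Kser (p + 1) u) R' -> (phi * (ps1 - psZ (/ (p + 1)) u) * A)%ps = ps1 -> cv A R' ->
  struve_f_equation q p b c delta alpha x <->
  Series (fun n => Kser (p + 1) u n * x ^ n) = 1 - alpha.
Proof.
  intros k phi Hc Hk Hp H Hx HK HA HcA; set (s := p + 1) in *.
  assert (Hu : nonneg u) by apply H.
  assert (Hu0 := neg_logder_u0 _ _ H).
  assert (He : entire phi) by (now apply phi_g_entire).
  destruct (Kser_cv s u R' Hp ltac:(lra) Hu HK) as (Hcu & Hcm).
  assert (HR : forall a, cv a R' -> cv a x) by (intro; apply cv_mono; lra).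
  set (psi := Top s phi).
  assert (Hpsi : entire psi) by (now apply entire_Top).
  assert (HcV : cv (Vser s u) x) by (apply cv_Vser; [lra|auto]).
  assert (E1 : PSeries phi x * PSeries (Vser s u) x * PSeries A x = 1).
  { assert (C1 : cv phi x) by (apply He; lra).
    rewrite <- !PSeries_psM by (auto; try apply cv_M; auto; lra).
    unfold Vser; rewrite HA; apply PSeries_psC. }
  assert (E2 : PSeries psi x = PSeries phi x * PSeries (Vser s u) x).
  { unfold psi; rewrite (Top_fact s phi u H); apply PSeries_psM; auto; [lra|apply He; lra]. }
  assert (E3 : PSeries (Vser s u) x = 1 - / s * PSeries u x).
  { unfold Vser; rewrite PSeries_psB, PSeries_psZ; auto using cv_Z; try lra.
    - unfold ps1; now rewrite PSeries_psC.
    - apply cv_C. }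
  assert (E4 : x * PSeries (dps psi) x = - (PSeries u x + PSeries (Mser s u) x) * PSeries psi x).
  { rewrite <- (PSeries_theta psi x (x + 1)); [|lra|apply Hpsi; lra].
    destruct (neg_logder_Top s phi u Hp H) as (_ & _ & E); fold psi in E; rewrite E.
    replace (- ((u + Mser s u) * psi))%ps with (psZ (-1) ((u + Mser s u) * psi)%ps)
      by (apply functional_extensionality; intro n; unfold psN, psZ; ring).
    assert (C1 : cv (u + Mser s u)%ps x) by (apply cv_D; auto; lra).
    assert (C2 : cv psi x) by (apply Hpsi; lra).
    rewrite PSeries_psZ, PSeries_psM, PSeries_psD by (auto using cv_M; try apply cv_M; auto; lra).
    ring. }
  assert (E5 : Series (fun n => Kser s u n * x ^ n) = / s * PSeries u x + PSeries (Mser s u) x).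
  { change (PSeries (Kser s u) x = / s * PSeries u x + PSeries (Mser s u) x).
    unfold Kser; rewrite PSeries_psD, PSeries_psZ; auto using cv_Z; lra. }
  assert (N1 : PSeries phi x <> 0) by (intro N; rewrite N in E1; lra).
  assert (N2 : PSeries (Vser s u) x <> 0) by (intro N; rewrite N in E1; lra).
  assert (N3 : PSeries psi x <> 0) by (rewrite E2; now apply Rmult_integral_contrapositive_currified).
  assert (HG : Gamma k <> 0) by (pose proof (Gamma_pos k Hk); lra).
  assert (HRp : Rpower (x / 2) s <> 0) by (pose proof (exp_pos (s * ln (x / 2))); unfold Rpower; lra).
  unfold struve_f_equation; cbv zeta.
  rewrite (is_derive_unique _ _ _ (struve_W_derive q p b c delta x Hc Hk (proj1 Hx) Hp)).
  rewrite (struve_W_derive2 q p b c delta x Hc Hk (proj1 Hx) Hp).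
  rewrite (struve_W_eq q p b c delta x Hc Hk (proj1 Hx)).
  fold k; fold phi; fold s; fold psi.
  assert (Q : 1 + (1 / s - 1) * (x * (/ Gamma k * (Rpower (x / 2) s * (s / x) * PSeries psi x))
        / (/ Gamma k * (Rpower (x / 2) s * PSeries phi x)))
      + x * (/ Gamma k * (Rpower (x / 2) s * (s / x) * (p / x * PSeries psi x + PSeries (dps psi) x)))
        / (/ Gamma k * (Rpower (x / 2) s * (s / x) * PSeries psi x))
      = 1 - Series (fun n => Kser s u n * x ^ n)).
  { transitivity (1 + (1 / s - 1) * (s * (PSeries psi x / PSeries phi x))
      + (p + x * PSeries (dps psi) x / PSeries psi x)).
    { field; repeat split; auto; lra. }
    rewrite E4, E5, E2; replace p with (s - 1) by (unfold s; ring).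
    transitivity (1 + (1 / s - 1) * (s * PSeries (Vser s u) x)
       + (s - 1 - (PSeries u x + PSeries (Mser s u) x))); [field; auto; lra|].
    rewrite E3; field; lra. }
  rewrite Q; split.
  - intros (_ & _ & E); lra.
  - intro E; repeat split; [| |lra];
      repeat apply Rmult_integral_contrapositive_currified; auto;
      try (apply Rinv_neq_0_compat; auto; lra); lra.
Qed.

(** The hypothesis [hkappa] keeps all arguments of [Gamma] where Euler's integral converges; $p+1>0$
    alone does not ensure this when $\delta$ is small. *)
Theorem theorem2p5 (q : nat) (delta b c p alpha : R)
  (hq : (0 < q)%nat) (hdelta : 0 < delta) (hb : 0 < b) (hc : 0 < c)
  (hp : 0 < p + 1) (hkappa : 0 < p / delta + (b + 2) / 2)
  (halpha : 0 <= alpha < 1) :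
  (exists r : R,
     is_smallest_positive_root (struve_f_equation q p b c delta alpha) r /\
     convexity_radius alpha (struve_f q p b c delta) = Finite r) /\
  (exists r : R,
     is_smallest_positive_root
       (convexity_equation alpha (struve_g q p b c delta)) r /\
     convexity_radius alpha (struve_g q p b c delta) = Finite r) /\
  (exists r : R,
     is_smallest_positive_root
       (convexity_equation alpha (struve_h q p b c delta)) r /\
     convexity_radius alpha (struve_h q p b c delta) = Finite r).
Proof.
  set (k := struve_kappa p b delta).
  assert (hc0 : 0 <= c) by lra.
  assert (hk : 0 < k) by exact hkappa.
  destruct (struve_series_logder c k q hc0 hk hq) as (u & Hu).
  pose proof (neg_logder_sc (/ 4) _ _ ltac:(lra) Hu) as Hh.
  pose proof (neg_logder_sq _ _ Hh) as Hg; set (v := psZ 2 _) in Hg.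
  assert (Eh : entire (phi_h c k q)) by (apply entire_sc; [lra|now apply struve_series_entire]).
  assert (Eg : entire (phi_g c k q)) by (now apply phi_g_entire).
  (* This coefficient is a nonzero multiple of $c$; it keeps $k$ from being the zero series. *)
  assert (Nh : phi_h c k q 1%nat <> 0).
  { unfold phi_h, sc, struve_series; pose proof (rf_pos k (q * 1) hk).
    simpl; unfold Rdiv.
    repeat apply Rmult_integral_contrapositive_currified; try lra;
      apply Rinv_neq_0_compat; lra. }
  fold (phi_h c k q) in Hh; fold (phi_g c k q) in Hg.
  assert (Nh' : exists n, phi_h c k q (S n) <> 0) by (now exists 0%nat).
  assert (Ng' : exists n, phi_g c k q (S n) <> 0).
  (* Degree 2 in [phi_g] is degree 1 in [phi_h]. *)
  { exists 1%nat; exact Nh. }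
  split; [|split].
  - destruct (convexity_root (phi_g c k q) v (p + 1) (1 - alpha) Eg Hg Ng' hp ltac:(lra))
      as (r & R' & Hr & HK & HS & A & HA & HcA).
    exists r; split.
    + split; [lra|]; split.
      * now apply (struve_f_equation_series q p b c delta alpha r v R' A).
      (* A root below [r] also lies inside the disk of convergence, where $k$ is strictly
         increasing. *)
      * intros x Hx E; apply Rnot_lt_le; intro Hlt.
        apply (struve_f_equation_series q p b c delta alpha x v R' A) in E; auto; [|lra].
        assert (Series (fun n => Kser (p + 1) v n * x ^ n) < 1 - alpha);
          [|lra].
        rewrite <- HS; apply Series_strict.
        -- apply cv_mono with R'; auto; lra.
        -- lra.
        -- apply nonneg_Kser; auto; apply Hg.
        -- now apply Kser_0, (neg_logder_u0 (phi_g c k q)).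
        -- now apply (Kser_pos_coef _ (phi_g c k q)).
    + replace (struve_f q p b c delta)
        with (fun z => z * Cexp (Clog_branch (ev (phi_g c k q)) z * RtoC (/ (p + 1))))%C.
      * now apply (convexity_power alpha _ v (p + 1) r R' A).
      * apply functional_extensionality; intro z; unfold struve_f.
        now rewrite struve_phi_ev.
  - replace (struve_g q p b c delta) with (fun z => z * ev (phi_g c k q) z)%C.
    + now apply convexity_z_series with v.
    + apply functional_extensionality; intro z; unfold struve_g.
      now rewrite struve_phi_ev.
  - rewrite struve_h_ev by assumption.
    now apply convexity_z_series with (sc (/ 4) u).
Qed.
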